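(* Satisfiability and finite satisfiability of $\mathrm{LTL}(\sim)$ are logspace-reducible to $\mathbf{\Delta^3_0}$.
   Context: Let $\mathrm{AP}$ be a countably infinite set of atomic propositions. A trace is an infinite sequence $t=t(0)t(1)\cdots\in(\wp\mathrm{AP})^\omega$, and $t^i=t(i)t(i+1)\cdots$. A team is a (possibly empty) set $T$ of traces, and $T^i=\{t^i: t\in T\}$. Formulas of $\mathrm{LTL}(\sim)$ are given by $\varphi::=p\mid\neg\varphi\mid\varphi\wedge\varphi\mid\varphi\vee\varphi\mid\mathsf X\varphi\mid\mathsf F\varphi\mid\mathsf G\varphi\mid\varphi\,\mathsf U\,\varphi\mid\varphi\,\mathsf R\,\varphi\mid{\sim}\varphi$ with $p\in\mathrm{AP}$. Synchronous team semantics: $T\models p$ iff $p\in t(0)$ for all $t\in T$; $T\models\neg\varphi$ iff $\{t\}\not\models\varphi$ for all $t\in T$; $T\models\varphi\wedge\psi$ iff $T\models\varphi$ and $T\models\psi$; $T\models\varphi\vee\psi$ iff $T=S\cup U$ for some $S,U$ with $S\models\varphi$ and $U\models\psi$; $T\models\mathsf X\varphi$ iff $T^1\models\varphi$; $T\models\mathsf F\varphi$ iff $T^k\models\varphi$ for some $k\ge0$; $T\models\mathsf G\varphi$ iff $T^k\models\varphi$ for all $k\ge0$; $T\models\varphi\,\mathsf U\,\psi$ iff there is $k\ge0$ with $T^k\models\psi$ and $T^j\models\varphi$ for all $j<k$; $T\models\varphi\,\mathsf R\,\psi$ iff for all $k\ge0$, $T^k\models\psi$ or $T^j\models\varphi$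 for some $j<k$; $T\models{\sim}\varphi$ iff $T\not\models\varphi$. A finite Kripke structure is $K=(W,R,\eta,r)$ with $W$ finite nonempty, $R\subseteq W\times W$ serial, $\eta:W\to\wp\mathrm{AP}$ with finite labels, and root $r\in W$; a path is $\pi\in W^\omega$ with $\pi(0)=r$ and $(\pi(i),\pi(i+1))\in R$; it induces the trace $(\eta(\pi(i)))_{i\ge0}$; $T(K)$ is the team of all induced traces. Satisfiability: the set of formulas satisfied by some team. Finite satisfiability: the set of formulas satisfied by $T(K)$ for some finite Kripke structure $K$. $\mathbf{\Delta^3_0}$ denotes the set of closed formulas of third-order arithmetic (vocabulary $+,\times,0,1,=,\le$; first-order variables range over $\mathbb N$, second-order variables of arity $n$ over subsets of $\mathbb N^n$, third-order variables of type $(n_1,\dots,n_k)$ over subsets of $\wp(\mathbb N^{n_1})\times\cdots\times\wp(\mathbb N^{n_k})$, with atoms $\mathfrak a(A_1,\dots,A_k)$) that are true in the standard model $\mathbb N$. *)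

(* Defs.v *)
From Stdlib Require Import List Arith PeanoNat Bool.
Import ListNotations.

Inductive ltl : Type :=
| LAtom  : nat -> ltl
| LNeg   : ltl -> ltl
| LAnd   : ltl -> ltl -> ltl
| LOr    : ltl -> ltl -> ltl
| LX     : ltl -> ltl
| LF     : ltl -> ltl
| LG     : ltl -> ltl
| LU     : ltl -> ltl -> ltl
| LR     : ltl -> ltl -> ltl
| LTilde : ltl -> ltl.

(* a trace: t i is the set of atomic propositions true at position i *)
Definition trace := nat -> nat -> bool.
Definition team := trace -> Prop.

Definition tshift (k : nat) (T : team) : team :=
  fun u => exists t, T t /\ u = (fun i => t (k + i)).

Definition tsingleton (t : trace) : team := fun u => u = t.

Fixpoint tsat (T : team) (phi : ltl) {struct phi} : Prop :=
  match phi with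
  | LAtom p => forall t, T t -> t 0 p = true
  | LNeg a => forall t, T t -> ~ tsat (tsingleton t) a
  | LAnd a b => tsat T a /\ tsat T b
  | LOr a b => exists S U : team,
      (forall t, T t <-> (S t \/ U t)) /\ tsat S a /\ tsat U b
  | LX a => tsat (tshift 1 T) a
  | LF a => exists k, tsat (tshift k T) a
  | LG a => forall k, tsat (tshift k T) a
  | LU a b => exists k, tsat (tshift k T) b /\
                        forall j, j < k -> tsat (tshift j T) a
  | LR a b => forall k, tsat (tshift k T) b \/
                        exists j, j < k /\ tsat (tshift j T) a
  | LTilde a => ~ tsat T a
  end.

Definition ltl_satisfiable (phi : ltl) : Prop := exists T : team, tsat T phi.

(* finite Kripke structures: worlds are 0 .. kn-1 *)
Record kripke := Kripke {
  kn    : nat;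
  kR    : nat -> nat -> bool;
  keta  : nat -> nat -> bool;
  kroot : nat }.

Definition kripke_wf (K : kripke) : Prop :=
  kroot K < kn K /\
  (forall w, w < kn K -> exists v, v < kn K /\ kR K w v = true) /\
  (forall w, w < kn K -> exists b, forall p, keta K w p = true -> p < b).

Definition kpath (K : kripke) (pi : nat -> nat) : Prop :=
  pi 0 = kroot K /\
  forall i, pi i < kn K /\ kR K (pi i) (pi (S i)) = true.

Definition kteam (K : kripke) : team :=
  fun t => exists pi, kpath K pi /\ t = (fun i => keta K (pi i)).

Definition ltl_fin_satisfiable (phi : ltl) : Prop :=
  exists K, kripke_wf K /\ tsat (kteam K) phi.

Inductive term : Type :=
| TVar  : nat -> term
| TZero : term
| TOne  : term
| TAdd  : term -> term -> term
| TMul  : term -> term -> term.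

(* second-order variables are pairs (index, arity);
   third-order variables are pairs (index, type (n1,...,nk)) *)
Inductive fo3 : Type :=
| FEq   : term -> term -> fo3
| FLe   : term -> term -> fo3
| FAtom2 : nat -> nat -> list term -> fo3
| FAtom3 : nat -> list nat -> list (nat * nat) -> fo3
| FNot  : fo3 -> fo3
| FAnd  : fo3 -> fo3 -> fo3
| FOr   : fo3 -> fo3 -> fo3
| FEx1  : nat -> fo3 -> fo3
| FAll1 : nat -> fo3 -> fo3
| FEx2  : nat -> nat -> fo3 -> fo3
| FAll2 : nat -> nat -> fo3 -> fo3
| FEx3  : nat -> list nat -> fo3 -> fo3
| FAll3 : nat -> list nat -> fo3 -> fo3.

Fixpoint term_ok (c1 : list nat) (t : term) : Prop :=
  match t with
  | TVar i => In i c1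
  | TZero | TOne => True
  | TAdd a b | TMul a b => term_ok c1 a /\ term_ok c1 b
  end.

Fixpoint fo3_ok (c1 : list nat) (c2 : list (nat * nat))
         (c3 : list (nat * list nat)) (f : fo3) : Prop :=
  match f with
  | FEq a b | FLe a b => term_ok c1 a /\ term_ok c1 b
  | FAtom2 i n ts => In (i, n) c2 /\ length ts = n /\ Forall (term_ok c1) ts
  | FAtom3 i ty As => In (i, ty) c3 /\ map snd As = ty /\
                      Forall (fun p => In p c2) As
  | FNot g => fo3_ok c1 c2 c3 g
  | FAnd g h | FOr g h => fo3_ok c1 c2 c3 g /\ fo3_ok c1 c2 c3 h
  | FEx1 i g | FAll1 i g => fo3_ok (i :: c1) c2 c3 g
  | FEx2 i n g | FAll2 i n g => fo3_ok c1 ((i, n) :: c2) c3 g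
  | FEx3 i ty g | FAll3 i ty g => fo3_ok c1 c2 ((i, ty) :: c3) g
  end.

Definition fo3_closed (f : fo3) : Prop := fo3_ok [] [] [] f.

(* relations of arity n: subsets of N^n, represented as predicates on
   lists of length n (false elsewhere) *)
Definition rel := list nat -> Prop.
Definition rel_of_arity (n : nat) (R : rel) : Prop :=
  forall l, R l -> length l = n.
Definition rel3 := list rel -> Prop.
Definition rel3_of_type (ty : list nat) (a : rel3) : Prop :=
  forall Rs, a Rs -> Forall2 rel_of_arity ty Rs.

Fixpoint teval (s1 : nat -> nat) (t : term) : nat :=
  match t with
  | TVar i => s1 i
  | TZero => 0
  | TOne => 1
  | TAdd a b => teval s1 a + teval s1 b
  | TMul a b => teval s1 a * teval s1 b
  end.

Definition upd1 (s1 : nat -> nat) (i v : nat) : nat -> nat :=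
  fun j => if Nat.eqb j i then v else s1 j.
Definition upd2 (s2 : nat -> nat -> rel) (i n : nat) (R : rel)
  : nat -> nat -> rel :=
  fun j m => if Nat.eqb j i && Nat.eqb m n then R else s2 j m.
Definition upd3 (s3 : nat -> list nat -> rel3) (i : nat) (ty : list nat)
  (a : rel3) : nat -> list nat -> rel3 :=
  fun j l => if Nat.eq_dec j i then
               (if list_eq_dec Nat.eq_dec l ty then a else s3 j l)
             else s3 j l.

Fixpoint fo3_holds (s1 : nat -> nat) (s2 : nat -> nat -> rel)
         (s3 : nat -> list nat -> rel3) (f : fo3) : Prop :=
  match f with
  | FEq a b => teval s1 a = teval s1 b
  | FLe a b => teval s1 a <= teval s1 b
  | FAtom2 i n ts => s2 i n (map (teval s1) ts)
  | FAtom3 i ty As => s3 i ty (map (fun p => s2 (fst p) (snd p)) As)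
  | FNot g => ~ fo3_holds s1 s2 s3 g
  | FAnd g h => fo3_holds s1 s2 s3 g /\ fo3_holds s1 s2 s3 h
  | FOr g h => fo3_holds s1 s2 s3 g \/ fo3_holds s1 s2 s3 h
  | FEx1 i g => exists v, fo3_holds (upd1 s1 i v) s2 s3 g
  | FAll1 i g => forall v, fo3_holds (upd1 s1 i v) s2 s3 g
  | FEx2 i n g => exists R, rel_of_arity n R /\
                   fo3_holds s1 (upd2 s2 i n R) s3 g
  | FAll2 i n g => forall R, rel_of_arity n R ->
                   fo3_holds s1 (upd2 s2 i n R) s3 g
  | FEx3 i ty g => exists a, rel3_of_type ty a /\
                   fo3_holds s1 s2 (upd3 s3 i ty a) g
  | FAll3 i ty g => forall a, rel3_of_type ty a ->
                   fo3_holds s1 s2 (upd3 s3 i ty a) g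
  end.

Definition Delta30 (f : fo3) : Prop :=
  fo3_closed f /\
  fo3_holds (fun _ => 0) (fun _ _ _ => False) (fun _ _ _ => False) f.

Definition tok (k : nat) : list bool :=
  map (fun i => Nat.testbit k i) [4; 3; 2; 1; 0].

(* binary digits, most significant first; 0 |-> [false] *)
Definition bits (n : nat) : list bool :=
  map (fun i => Nat.testbit n i) (rev (seq 0 (S (Nat.log2 n)))).

(* token 0 = bit 0, 1 = bit 1, 2 = END *)
Definition enc_num (n : nat) : list bool :=
  flat_map (fun b : bool => tok (if b then 1 else 0)) (bits n) ++ tok 2.

Fixpoint enc_ltl (phi : ltl) : list bool :=
  match phi with
  | LAtom p => tok 3 ++ enc_num p
  | LNeg a => tok 4 ++ enc_ltl a
  | LAnd a b => tok 5 ++ enc_ltl a ++ enc_ltl b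
  | LOr a b => tok 6 ++ enc_ltl a ++ enc_ltl b
  | LX a => tok 7 ++ enc_ltl a
  | LF a => tok 8 ++ enc_ltl a
  | LG a => tok 9 ++ enc_ltl a
  | LU a b => tok 10 ++ enc_ltl a ++ enc_ltl b
  | LR a b => tok 11 ++ enc_ltl a ++ enc_ltl b
  | LTilde a => tok 12 ++ enc_ltl a
  end.

Fixpoint enc_term (t : term) : list bool :=
  match t with
  | TVar i => tok 13 ++ enc_num i
  | TZero => tok 14
  | TOne => tok 15
  | TAdd a b => tok 16 ++ enc_term a ++ enc_term b
  | TMul a b => tok 17 ++ enc_term a ++ enc_term b
  end.

Definition enc_nums (l : list nat) : list bool :=
  flat_map enc_num l ++ tok 2.

Fixpoint enc_fo3 (f : fo3) : list bool :=
  match f with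
  | FEq a b => tok 18 ++ enc_term a ++ enc_term b
  | FLe a b => tok 19 ++ enc_term a ++ enc_term b
  | FAtom2 i n ts => tok 20 ++ enc_num i ++ enc_num n ++
                     flat_map enc_term ts ++ tok 2
  | FAtom3 i ty As => tok 21 ++ enc_num i ++ enc_nums ty ++
                     flat_map (fun p => enc_num (fst p) ++ enc_num (snd p)) As
                     ++ tok 2
  | FNot g => tok 22 ++ enc_fo3 g
  | FAnd g h => tok 23 ++ enc_fo3 g ++ enc_fo3 h
  | FOr g h => tok 24 ++ enc_fo3 g ++ enc_fo3 h
  | FEx1 i g => tok 25 ++ enc_num i ++ enc_fo3 g
  | FAll1 i g => tok 26 ++ enc_num i ++ enc_fo3 g
  | FEx2 i n g => tok 27 ++ enc_num i ++ enc_num n ++ enc_fo3 g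
  | FAll2 i n g => tok 28 ++ enc_num i ++ enc_num n ++ enc_fo3 g
  | FEx3 i ty g => tok 29 ++ enc_num i ++ enc_nums ty ++ enc_fo3 g
  | FAll3 i ty g => tok 30 ++ enc_num i ++ enc_nums ty ++ enc_fo3 g
  end.

Definition SAT_lang (w : list bool) : Prop :=
  exists phi, w = enc_ltl phi /\ ltl_satisfiable phi.
Definition FinSAT_lang (w : list bool) : Prop :=
  exists phi, w = enc_ltl phi /\ ltl_fin_satisfiable phi.
Definition Delta30_lang (w : list bool) : Prop :=
  exists f, w = enc_fo3 f /\ Delta30 f.

Inductive move := MLeft | MStay | MRight.

(* deterministic transducer: read-only input tape with endmarkers,
   one work tape (alphabet 0..nG-1, blank 0), write-only output tape *)
Record TM := MkTM {
  tm_nQ : nat;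
  tm_nG : nat;
  tm_q0 : nat;
  tm_qH : nat;
  tm_delta : nat -> option bool -> nat ->
             nat * nat * move * move * option bool }.

Definition TM_wf (M : TM) : Prop :=
  tm_q0 M < tm_nQ M /\ tm_qH M < tm_nQ M /\ 0 < tm_nG M /\
  forall q a g, q < tm_nQ M -> g < tm_nG M ->
    match tm_delta M q a g with
    | (q', g', _, _, _) => q' < tm_nQ M /\ g' < tm_nG M
    end.

Record config := Cfg {
  c_q : nat;
  c_ih : nat;         (* input head: 0 = left marker, |w|+1 = right marker *)
  c_wh : nat;
  c_wt : nat -> nat;
  c_out : list bool   (* output written so far *) }.

Definition in_sym (w : list bool) (i : nat) : option bool :=
  match i with 0 => None | S j => nth_error w j end.

Definition move_in (w : list bool) (m : move) (i : nat) : nat :=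
  match m with
  | MLeft => pred i
  | MStay => i
  | MRight => Nat.min (S i) (S (length w))
  end.

Definition move_work (m : move) (i : nat) : nat :=
  match m with MLeft => pred i | MStay => i | MRight => S i end.

Definition tm_step (M : TM) (w : list bool) (c : config) : config :=
  if Nat.eqb (c_q c) (tm_qH M) then c else
  match tm_delta M (c_q c) (in_sym w (c_ih c)) (c_wt c (c_wh c)) with
  | (q', g', mi, mw, o) =>
      Cfg q' (move_in w mi (c_ih c)) (move_work mw (c_wh c))
          (fun k => if Nat.eqb k (c_wh c) then g' else c_wt c k)
          (c_out c ++ match o with Some b => [b] | None => [] end)
  end.

Definition tm_init (M : TM) : config := Cfg (tm_q0 M) 0 0 (fun _ => 0) [].

Definition tm_run (M : TM) (w : list bool) (n : nat) : config :=
  Nat.iter n (tm_step M w) (tm_init M).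

Definition tm_computes (M : TM) (f : list bool -> list bool) : Prop :=
  forall w, exists n, c_q (tm_run M w n) = tm_qH M /\
                      c_out (tm_run M w n) = f w.

Definition tm_logspace (M : TM) : Prop :=
  exists c, forall w n,
    c_wh (tm_run M w n) <= c * S (Nat.log2 (S (length w))).

Definition logspace_computable (f : list bool -> list bool) : Prop :=
  exists M, TM_wf M /\ tm_computes M f /\ tm_logspace M.

Definition logspace_reducible (A B : list bool -> Prop) : Prop :=
  exists f, logspace_computable f /\ forall w, A w <-> B (f w).

(* Main.v *)
(** Teams are third-order objects, so the team semantics can be written down in third-order
    arithmetic clause by clause, with one fixed third-order variable for the current team that is
    rebound at every connective. In prefix notation each token then contributes a fixed string
    depending on nothing else, even for binary connectives: the team of the second operand is bound
    before the connective, and that of the first operand is rebound inside it. An atom is computed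
    digit by digit through rebinding of a first-order variable. Hence a finite-state transducer,
    which uses no work space at all, performs the reduction. Unique readability of prefix notation
    shows that ill-formed inputs have ill-formed outputs. *)

From Stdlib Require Import List Arith PeanoNat Bool Lia.
From Stdlib Require Import Classical ClassicalEpsilon FunctionalExtensionality PropExtensionality.
Require Import Defs.
Import ListNotations.

(** * Finite-state transducers as Turing machines *)

(** A device with finite memory cannot count the operands still to come, so it cannot tell whether a
    formula is incomplete or followed by further symbols. The count is kept by the output instead:
    the string of a token opens exactly as many operands as the token, so an output that parses as a
    list of formulas yields a parse of the input as a list of the same length. The defects to be
    caught by the transducer are those that the arithmetic side would hide, above all numerals with
    leading zeros, which would translate into well-formed formulas. A fixed stock of variables
    suffices because the truth of a translated formula depends on the current team alone; operands
    may rebind everything else. For finite satisfiability, a Kripke structure consists of two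
    numbers and two binary relations, and its team is definable by quantifying over graphs of
    paths. *)

Record transducer := {
  td_state  : Type;
  td_all    : list td_state;
  td_finite : forall q, In q td_all;
  td_start  : td_state;
  td_prefix : list bool;
  td_next   : td_state -> bool -> td_state;
  td_out    : td_state -> bool -> list bool;
  td_finish : td_state -> list bool }.

Fixpoint td_run (D : transducer) (q : td_state D) (w : list bool) : list bool :=
  match w with
  | [] => td_finish D q
  | b :: w' => td_out D q b ++ td_run D (td_next D q b) w'
  end.

Definition td_fun (D : transducer) (w : list bool) : list bool :=
  td_prefix D ++ td_run D (td_start D) w.

(** Both endmarkers are read as [None]; the control state tells the left one, under which the head
    starts, from the right one, which ends the input. *)
Inductive ctrl (S : Type) := CInit | CRead (q : S) | CHalt.
Arguments CInit {S}.
Arguments CRead {S} q.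
Arguments CHalt {S}.

(* A machine emits at most one bit per step, so its state carries the output still pending. *)
Definition mstate (D : transducer) : Type := (ctrl (td_state D) * list bool)%type.

Definition mstep (D : transducer) (x : mstate D) (a : option bool)
  : mstate D * move * option bool :=
  let (k, s0) := x in
  match s0 with
  | b :: s => ((k, s), MStay, Some b)
  | [] =>
      match k with
      | CInit => ((CRead (td_start D), td_prefix D), MRight, None)
      | CRead q =>
          match a with
          | Some b => ((CRead (td_next D q b), td_out D q b), MRight, None)
          | None => ((CHalt, td_finish D q), MStay, None)
          end
      | CHalt => (x, MStay, None)
      end
  end.

Fixpoint suffixes (s : list bool) : list (list bool) :=
  s :: match s with [] => [] | _ :: s' => suffixes s' end.

Lemma suffixes_refl s : In s (suffixes s).
Proof. destruct s; simpl; auto. Qed.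

Lemma suffixes_nil s : In [] (suffixes s).
Proof. induction s; simpl; auto. Qed.

Lemma suffixes_tail b s u : In (b :: s) (suffixes u) -> In s (suffixes u).
Proof.
  induction u as [|c u IH]; simpl.
  - intros [H|[]]; discriminate.
  - intros [H|H]; [injection H as -> ->; right; apply suffixes_refl | auto].
Qed.

(** Pending output only loses bits at the front, so it is always a suffix of one of the finitely
    many words that the transducer writes. This keeps the machine's state set finite. *)
Definition pending (D : transducer) : list (list bool) :=
  flat_map suffixes
    (td_prefix D :: flat_map (fun q => [td_finish D q; td_out D q true; td_out D q false])
                              (td_all D)).

Definition mstates (D : transducer) : list (mstate D) :=
  list_prod (CInit :: CHalt :: map CRead (td_all D)) (pending D).

Lemma pending_tail D b s : In (b :: s) (pending D) -> In s (pending D).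
Proof.
  unfold pending; rewrite !in_flat_map.
  intros [u [H1 H2]]; exists u; split; [exact H1 | eapply suffixes_tail; eassumption].
Qed.

Lemma in_pending D u :
  In u (td_prefix D :: flat_map (fun q => [td_finish D q; td_out D q true; td_out D q false])
                              (td_all D)) -> In u (pending D).
Proof. intro H; unfold pending; apply in_flat_map; exists u; auto using suffixes_refl. Qed.

Lemma in_ctrls D (k : ctrl (td_state D)) : In k (CInit :: CHalt :: map CRead (td_all D)).
Proof. destruct k; simpl; auto. right; right. apply in_map, td_finite. Qed.

Lemma in_mstates D k s : In s (pending D) -> In (k, s) (mstates D).
Proof. intro H; apply in_prod; [apply in_ctrls | exact H]. Qed.

Lemma mstep_in D x a : In x (mstates D) -> In (fst (fst (mstep D x a))) (mstates D).
Proof.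
  destruct x as [k s]; intro H.
  pose proof H as H'. apply in_prod_iff in H' as [_ Hs].
  destruct s as [|b s]; simpl.
  - destruct k as [|q|]; simpl; try exact H.
    + apply in_mstates, in_pending; simpl; auto.
    + destruct a as [[]|]; simpl; apply in_mstates, in_pending; right;
        apply in_flat_map; exists q; (split; [apply td_finite | simpl; auto]).
  - apply in_mstates. eapply pending_tail; eassumption.
Qed.

(** Machine states are numbers, so states are replaced by positions in the list. The list may repeat
    entries and equality need not be decidable: [code] picks some position by choice, and only
    [decode] after [code] is the identity. *)
Lemma finite_code (X : Type) (x0 : X) (l : list X) : In x0 l ->
  exists (code : X -> nat) (decode : nat -> X),
    (forall x, In x l -> decode (code x) = x /\ code x < length l) /\
    (forall n, n < length l -> In (decode n) l).
Proof.
  intro H0.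
  assert (H : forall x, exists n, In x l -> nth n l x0 = x /\ n < length l).
  { intro x. destruct (classic (In x l)) as [Hx|Hx].
    - destruct (In_nth l x x0 Hx) as [n [? ?]]; exists n; auto.
    - exists 0; tauto. }
  exists (fun x => proj1_sig (constructive_indefinite_description _ (H x))),
         (fun n => nth n l x0).
  split.
  - intros x Hx. destruct (constructive_indefinite_description _ (H x)); simpl; auto.
  - intros n Hn; apply nth_In; exact Hn.
Qed.

Lemma transducer_logspace (D : transducer) : logspace_computable (td_fun D).
Proof.
  assert (Hnil : In [] (pending D)).
  { unfold pending; simpl. apply in_or_app; left; apply suffixes_nil. }
  assert (Hi : In (CInit, []) (mstates D)) by (apply in_mstates; exact Hnil).
  assert (Hh : In (CHalt, []) (mstates D)) by (apply in_mstates; exact Hnil).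
  destruct (finite_code _ _ _ Hi) as [code [decode [Hcd Hdc]]].
  set (delta := fun (n : nat) (a : option bool) (_ : nat) =>
                  match mstep D (decode n) a with
                  | (x, mi, o) => (code x, 0, mi, MStay, o)
                  end).
  set (M := MkTM (length (mstates D)) 1 (code (CInit, [])) (code (CHalt, [])) delta).
  exists M; split; [|split].
  - repeat split; simpl; try apply Hcd; auto.
    intros q a g Hq _. unfold delta.
    pose proof (mstep_in D (decode q) a (Hdc q Hq)) as Hin.
    destruct (mstep D (decode q) a) as [[x mi] o]; simpl in Hin.
    split; [apply Hcd, Hin | lia].
  - intro w.
    assert (Hstep : forall x c, In x (mstates D) -> x <> (CHalt, []) -> c_q c = code x ->
       let r := mstep D x (in_sym w (c_ih c)) in
       let c' := tm_step M w c in
       c_q c' = code (fst (fst r)) /\ c_ih c' = move_in w (snd (fst r)) (c_ih c) /\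
       c_out c' = c_out c ++ match snd r with Some b => [b] | None => [] end).
    { intros x c Hx Hne Hq r c'. unfold c', tm_step. simpl.
      replace (Nat.eqb (c_q c) (code (CHalt, []))) with false.
      - unfold delta. rewrite Hq, (proj1 (Hcd x Hx)). fold r.
        destruct r as [[y mi] o]; simpl; auto.
      (* The halting test compares codes; [code] is injective on [mstates] because [decode] undoes
         it. *)
      - symmetry; apply Nat.eqb_neq; rewrite Hq; intro E.
        apply Hne. rewrite <- (proj1 (Hcd x Hx)), E. apply Hcd, Hh. }
    (* The tape is left out: it is rewritten in each step, to a function that is only extensionally equal. *)
    set (reach := fun c q ih out => exists n,
       c_q (Nat.iter n (tm_step M w) c) = q /\ c_ih (Nat.iter n (tm_step M w) c) = ih /\
       c_out (Nat.iter n (tm_step M w) c) = out).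
    assert (Hemit : forall s k c, In s (pending D) -> c_q c = code (k, s) ->
       reach c (code (k, [])) (c_ih c) (c_out c ++ s)).
    { induction s as [|b s IH]; intros k c Hs Hq.
      - exists 0; simpl; rewrite app_nil_r; auto.
      - pose proof (Hstep (k, b :: s) c (in_mstates D _ _ Hs) ltac:(discriminate) Hq) as [E1 [E2 E3]].
        simpl in E1, E2, E3.
        destruct (IH k (tm_step M w c)) as [n [F1 [F2 F3]]]; eauto using pending_tail.
        exists (S n). rewrite Nat.iter_succ_r, F1, F2, F3, E2, E3, <- app_assoc; auto. }
    assert (Hread : forall v u q c, w = u ++ v -> c_q c = code (CRead q, []) ->
       c_ih c = S (length u) ->
       exists n, c_q (Nat.iter n (tm_step M w) c) = code (CHalt, []) /\
                 c_out (Nat.iter n (tm_step M w) c) = c_out c ++ td_run D q v).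
    { induction v as [|b v IH]; intros u q c Hw Hq Hih.
      - pose proof (Hstep (CRead q, []) c (in_mstates D _ _ Hnil) ltac:(discriminate) Hq) as [E1 [E2 E3]].
        assert (Ea : in_sym w (c_ih c) = None).
        { rewrite Hih; simpl. apply nth_error_None. rewrite Hw, app_nil_r. lia. }
        rewrite Ea in *. simpl in E1, E2, E3.
        destruct (Hemit (td_finish D q) CHalt (tm_step M w c)) as [n [F1 [F2 F3]]]; auto.
        { apply in_pending; right; apply in_flat_map; exists q.
          split; [apply td_finite | simpl; auto]. }
        exists (S n). rewrite Nat.iter_succ_r, F1, F3, E3, app_nil_r; auto.
      - pose proof (Hstep (CRead q, []) c (in_mstates D _ _ Hnil) ltac:(discriminate) Hq) as [E1 [E2 E3]].
        assert (Ea : in_sym w (c_ih c) = Some b).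
        { rewrite Hih; simpl. rewrite Hw, nth_error_app2, Nat.sub_diag by lia. reflexivity. }
        rewrite Ea in *. simpl in E1, E2, E3.
        destruct (Hemit (td_out D q b) (CRead (td_next D q b)) (tm_step M w c))
          as [n [F1 [F2 F3]]]; auto.
        { apply in_pending; right; apply in_flat_map; exists q.
          split; [apply td_finite | destruct b; simpl; auto]. }
        destruct (IH (u ++ [b]) (td_next D q b) (Nat.iter n (tm_step M w) (tm_step M w c)))
          as [m [G1 G2]]; auto.
        { rewrite Hw, <- app_assoc; reflexivity. }
        { rewrite F2, E2, Hih, length_app. cbn [move_in length].
          assert (length w = length u + S (length v)) by (rewrite Hw, length_app; reflexivity).
          lia. }
        exists (m + S n). rewrite Nat.iter_add, Nat.iter_succ_r, G1, G2, F3, E3, app_nil_r.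
        simpl. rewrite <- app_assoc; auto. }
    pose proof (Hstep (CInit, []) (tm_init M) Hi ltac:(discriminate) eq_refl) as [E1 [E2 E3]].
    simpl in E1, E2, E3.
    destruct (Hemit (td_prefix D) (CRead (td_start D)) (tm_step M w (tm_init M)))
      as [n [F1 [F2 F3]]]; auto.
    { apply in_pending; simpl; auto. }
    destruct (Hread w [] (td_start D) (Nat.iter n (tm_step M w) (tm_step M w (tm_init M))))
      as [m [G1 G2]]; auto.
    { rewrite F2, E2. cbn [move_in length]. lia. }
    exists (m + S n). unfold tm_run. rewrite Nat.iter_add, Nat.iter_succ_r, G1, G2, F3, E3.
    auto.
  (* Every transition leaves the work head where it is, on cell 0, so even the constant 0 bounds the
     space. *)
  - exists 0. intros w n. simpl.
    enough (c_wh (tm_run M w n) = 0) by lia.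
    unfold tm_run. induction n as [|n IH]; [reflexivity|].
    simpl Nat.iter. unfold tm_step at 1.
    destruct (Nat.eqb _ _); [exact IH|]. simpl. unfold delta.
    destruct (mstep D _ _) as [[x mi] o]. simpl. rewrite IH. reflexivity.
Qed.

(** * Unique readability of the encodings *)

Lemma tok_app_inj a b X Y :
  a < 32 -> b < 32 -> tok a ++ X = tok b ++ Y -> a = b /\ X = Y.
Proof.
  intros Ha Hb H. unfold tok in H; simpl map in H; simpl app in H.
  injection H as H4 H3 H2 H1 H0 HX. split; [|exact HX].
  apply Nat.bits_inj. intro n.
  (* A token shows the bits 0 to 4; from bit 5 on, numbers below 32 have only zeros. *)
  destruct (le_lt_dec 5 n) as [Hn|Hn].
  - assert (Z : forall c, c < 32 -> Nat.testbit c n = false).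
    { intros c Hc. destruct (Nat.eq_dec c 0) as [->|]; [apply Nat.bits_0|].
      apply Nat.bits_above_log2.
      assert (Nat.log2 c < 5) by (apply Nat.log2_lt_pow2; simpl; lia). lia. }
    rewrite !Z; auto.
  - do 5 (destruct n as [|n]; [assumption|]). lia.
Qed.

Arguments tok : simpl never.

Definition prefix_code {X : Type} (e : X -> list bool) : Prop :=
  forall x y u v, e x ++ u = e y ++ v -> x = y /\ u = v.

(** No entry starts with the end token 2, so the reader always knows whether another entry
    follows. *)
Lemma prefix_code_list {X : Type} (e : X -> list bool) :
  prefix_code e -> (forall x, exists k s, k < 32 /\ k <> 2 /\ e x = tok k ++ s) ->
  prefix_code (fun l => flat_map e l ++ tok 2).
Proof.
  intros He Hs. intro l.
  induction l as [|x l IH]; intros [|y l'] u v H; cbn [flat_map] in H;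
    rewrite <- ?app_assoc, ?app_nil_l in H.
  - apply tok_app_inj in H; try lia. tauto.
  - destruct (Hs y) as [k [s [K1 [K2 E]]]]. rewrite E, <- app_assoc in H.
    apply tok_app_inj in H; lia.
  - destruct (Hs x) as [k [s [K1 [K2 E]]]]. rewrite E, <- app_assoc in H.
    apply tok_app_inj in H; lia.
  - apply He in H as [-> H].
    specialize (IH l' u v). rewrite <- !app_assoc in IH. destruct (IH H) as [-> ->]. auto.
Qed.

Lemma bits_inj m n : bits m = bits n -> m = n.
Proof.
  unfold bits. intro H.
  (* The number of digits fixes the logarithm, so both lists test the same bit positions. *)
  assert (E : Nat.log2 m = Nat.log2 n).
  { apply (f_equal (@length bool)) in H. rewrite !length_map, !length_rev, !length_seq in H. lia. }
  rewrite E in H. apply Nat.bits_inj. intro i.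
  destruct (le_lt_dec i (Nat.log2 n)) as [Hi|Hi].
  - rewrite map_ext_in_iff in H. apply H. apply -> in_rev. apply in_seq. lia.
  - rewrite !Nat.bits_above_log2; auto; lia.
Qed.

Lemma prefix_code_num : prefix_code enc_num.
Proof.
  intros x y u v H. unfold enc_num in H.
  apply (prefix_code_list (fun b : bool => tok (if b then 1 else 0))) in H as [H ->].
  - auto using bits_inj.
  - intros a b u' v' E. apply tok_app_inj in E as [E ->]; [|destruct a; lia|destruct b; lia].
    destruct a, b; auto; discriminate.
  - intros []; [exists 1 | exists 0]; exists []; rewrite app_nil_r; repeat split; lia.
Qed.

Lemma bits_nonnil n : exists b l, bits n = b :: l.
Proof.
  unfold bits. rewrite seq_S, rev_app_distr. simpl. eauto.
Qed.

Lemma enc_num_head n : exists k s, k < 2 /\ enc_num n = tok k ++ s.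
Proof.
  unfold enc_num. destruct (bits_nonnil n) as [b [l ->]].
  cbn [flat_map]. rewrite <- !app_assoc.
  exists (if b then 1 else 0). eexists. split; [destruct b; lia | reflexivity].
Qed.

Lemma prefix_code_nums : prefix_code enc_nums.
Proof.
  apply prefix_code_list; [exact prefix_code_num|].
  intro n. destruct (enc_num_head n) as [k [s [? E]]]. exists k, s. repeat split; auto; lia.
Qed.

Lemma enc_term_head t : exists k s, 12 < k < 18 /\ enc_term t = tok k ++ s.
Proof.
  destruct t; cbn [enc_term]; eexists _, _; (split; [|reflexivity || (symmetry; apply app_nil_r)]); lia.
Qed.

Ltac tok_inv H :=
  rewrite <- ?app_assoc in H; apply tok_app_inj in H as [? H]; [try discriminate|lia|lia].

Lemma prefix_code_term : prefix_code enc_term.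
Proof.
  intro t; induction t; intros [] u v H; cbn [enc_term] in H; tok_inv H; subst; auto.
  - apply prefix_code_num in H as [-> ->]; auto.
  - apply IHt1 in H as [-> H]. apply IHt2 in H as [-> ->]; auto.
  - apply IHt1 in H as [-> H]. apply IHt2 in H as [-> ->]; auto.
Qed.

Lemma prefix_code_args : prefix_code (fun l => flat_map enc_term l ++ tok 2).
Proof.
  apply prefix_code_list; [exact prefix_code_term|].
  intro t. destruct (enc_term_head t) as [k [s [? E]]]. exists k, s. repeat split; auto; lia.
Qed.

Lemma prefix_code_vars :
  prefix_code (fun l => flat_map (fun p => enc_num (fst p) ++ enc_num (snd p)) l ++ tok 2).
Proof.
  apply (prefix_code_list (fun p : nat * nat => enc_num (fst p) ++ enc_num (snd p))).
  - intros [a b] [c d] u v H. cbn [fst snd] in H. rewrite <- !app_assoc in H.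
    apply prefix_code_num in H as [-> H]. apply prefix_code_num in H as [-> ->]. auto.
  - intros [a b]. destruct (enc_num_head a) as [k [s [? E]]]. cbn [fst snd]. rewrite E.
    exists k. eexists. rewrite <- app_assoc. repeat split; lia.
Qed.

Lemma prefix_code_fo3 : prefix_code enc_fo3.
Proof.
  intro f; induction f; intros [] u v H; cbn [enc_fo3] in H; tok_inv H;
    rewrite <- ?app_assoc in H;
    repeat match goal with
    | H : enc_num _ ++ _ = _ |- _ => apply prefix_code_num in H as [-> H]
    | H : enc_nums _ ++ _ = _ |- _ => apply prefix_code_nums in H as [-> H]
    | H : enc_term _ ++ _ = _ |- _ => apply prefix_code_term in H as [-> H]
    | IH : forall _ _ _, enc_fo3 ?f ++ _ = _ -> _, H : enc_fo3 ?f ++ _ = _ |- _ =>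
        apply IH in H as [-> H]
    end; subst; auto.
  - pose proof (prefix_code_args l l0 u v) as P. cbv beta in P. rewrite <- !app_assoc in P.
    destruct (P H) as [-> ->]; auto.
  - pose proof (prefix_code_vars l0 l2 u v) as P. cbv beta in P. rewrite <- !app_assoc in P.
    destruct (P H) as [-> ->]; auto.
Qed.

Lemma enc_fo3_head f : exists k s, 17 < k < 31 /\ enc_fo3 f = tok k ++ s.
Proof. destruct f; cbn [enc_fo3]; eexists _, _; (split; [|reflexivity]); lia. Qed.
(** * The translation *)

(* The encoding of a formula built by an [opener] starts with the string of the opener, so a
   token of an LTL formula can be translated to a list of openers without knowing its operands. *)
Inductive opener :=
| OEx1 (i : nat) | OAll1 (i : nat)
| OEx2 (i n : nat) | OAll2 (i n : nat)
| OEx3 (i : nat) (ty : list nat)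
| ONot
| OAndC (f : fo3) | OOrC (f : fo3)
| OAnd | OOr.

Definition enc_opener (o : opener) : list bool :=
  match o with
  | OEx1 i => tok 25 ++ enc_num i
  | OAll1 i => tok 26 ++ enc_num i
  | OEx2 i n => tok 27 ++ enc_num i ++ enc_num n
  | OAll2 i n => tok 28 ++ enc_num i ++ enc_num n
  | OEx3 i ty => tok 29 ++ enc_num i ++ enc_nums ty
  | ONot => tok 22
  | OAndC f => tok 23 ++ enc_fo3 f
  | OOrC f => tok 24 ++ enc_fo3 f
  | OAnd => tok 23
  | OOr => tok 24
  end.

(** The list acts as a stack in prefix order: an opener takes its operands from the front and puts
    the compound formula there. The last case is a dummy for missing operands. *)
Definition apply_opener (o : opener) (fs : list fo3) : list fo3 :=
  match o, fs with
  | OEx1 i, f :: fs => FEx1 i f :: fs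
  | OAll1 i, f :: fs => FAll1 i f :: fs
  | OEx2 i n, f :: fs => FEx2 i n f :: fs
  | OAll2 i n, f :: fs => FAll2 i n f :: fs
  | OEx3 i ty, f :: fs => FEx3 i ty f :: fs
  | ONot, f :: fs => FNot f :: fs
  | OAndC g, f :: fs => FAnd g f :: fs
  | OOrC g, f :: fs => FOr g f :: fs
  | OAnd, f :: g :: fs => FAnd f g :: fs
  | OOr, f :: g :: fs => FOr f g :: fs
  | _, _ => []
  end.

Definition apply_openers (os : list opener) (fs : list fo3) : list fo3 :=
  fold_right apply_opener fs os.

Definition close (os : list opener) (fs : list fo3) : fo3 :=
  hd (FEq TZero TOne) (apply_openers os fs).

Definition binary (o : opener) : nat := match o with OAnd | OOr => 1 | _ => 0 end.

Fixpoint binaries (os : list opener) : nat :=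
  match os with [] => 0 | o :: os' => binary o + binaries os' end.

(** One formula is due at the outset; a unary opener fills that place and creates one, a binary
    opener creates one more. *)
Definition arity (os : list opener) : nat := S (binaries os).

Lemma enc_apply_opener o fs : S (binary o) <= length fs ->
  flat_map enc_fo3 (apply_opener o fs) = enc_opener o ++ flat_map enc_fo3 fs /\
  S (length (apply_opener o fs)) = length fs - binary o + 1.
Proof.
  destruct o, fs as [|f1 [|f2 fs]]; cbn [binary length]; intro H; try lia;
    cbn [apply_opener flat_map enc_fo3 enc_opener length]; rewrite <- ?app_assoc;
    split; try reflexivity; lia.
Qed.

Lemma enc_apply_openers os fs : arity os <= length fs ->
  flat_map enc_fo3 (apply_openers os fs) = flat_map enc_opener os ++ flat_map enc_fo3 fs /\
  length (apply_openers os fs) + binaries os = length fs.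
Proof.
  unfold arity; induction os as [|o os IH]; cbn [apply_openers fold_right binaries flat_map];
    intro H.
  - split; [reflexivity | lia].
  - destruct IH as [IH1 IH2]; [lia|].
    fold (apply_openers os fs).
    destruct (enc_apply_opener o (apply_openers os fs)) as [E1 E2]; [lia|].
    rewrite E1, IH1, <- app_assoc. split; [reflexivity | lia].
Qed.

Lemma enc_close os fs : length fs = arity os ->
  enc_fo3 (close os fs) = flat_map enc_opener os ++ flat_map enc_fo3 fs.
Proof.
  intro H. destruct (enc_apply_openers os fs) as [E L]; [lia|].
  rewrite <- E. unfold close, arity in *.
  destruct (apply_openers os fs) as [|f [|]]; cbn [length] in L; try lia.
  cbn. symmetry; apply app_nil_r.
Qed.

(** The leading token fixes the constructor of the first formula, and the prefix codes strip its
    parameters. What remains are the operands of that formula followed by the other formulas. *)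
Lemma enc_opener_inv o X fs : enc_opener o ++ X = flat_map enc_fo3 fs ->
  exists gs, X = flat_map enc_fo3 gs /\ length gs = binary o + length fs /\ fs <> [].
Proof.
  intro H. destruct fs as [|f fs].
  - destruct o; discriminate H.
  - destruct o, f; cbn [enc_opener flat_map enc_fo3 binary] in *; tok_inv H;
    rewrite <- ?app_assoc in H;
    repeat match goal with
    | H : enc_num _ ++ _ = _ |- _ => apply prefix_code_num in H as [? H]
    | H : enc_nums _ ++ _ = _ |- _ => apply prefix_code_nums in H as [? H]
    | H : enc_fo3 _ ++ _ = enc_fo3 _ ++ _ |- _ => apply prefix_code_fo3 in H as [? H]
    end; subst X;
    match goal with
    | |- context [enc_fo3 ?a ++ enc_fo3 ?b ++ flat_map enc_fo3 ?l] => exists (a :: b :: l)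
    | |- context [enc_fo3 ?a ++ flat_map enc_fo3 ?l] => exists (a :: l)
    end; repeat split; discriminate.
Qed.

Lemma enc_openers_inv os X fs : os <> [] -> flat_map enc_opener os ++ X = flat_map enc_fo3 fs ->
  exists gs, X = flat_map enc_fo3 gs /\ S (length gs) = arity os + length fs /\ fs <> [].
Proof.
  unfold arity. revert fs. induction os as [|o os IH]; intros fs Hn H; [congruence|].
  cbn [flat_map] in H. rewrite <- app_assoc in H.
  apply enc_opener_inv in H as [gs [H [L N]]].
  destruct os as [|o' os].
  - exists gs. cbn in *. repeat split; auto; lia.
  - destruct (IH gs) as [hs [H' [L' N']]]; auto; try discriminate.
    exists hs. cbn in *. repeat split; auto; lia.
Qed.

(* Third-order variables 0, 1, 2 range over teams; 0 is the team at which a formula is evaluated.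
   Second-order variables 0, 1 of arity 2 range over traces. *)
Definition inT (X t : nat) : fo3 := FAtom3 X [2] [(t, 2)].
Definition fimp (f g : fo3) : fo3 := FOr (FNot f) g.
Definition fiff (f g : fo3) : fo3 := FAnd (fimp f g) (fimp g f).

(** The syntax equates numbers only, so equality of teams is expressed extensionally, through their
    members. *)
Definition eqT (X Y : nat) : fo3 := FAll2 0 2 (fiff (inT X 0) (inT Y 0)).

Definition unionT (X Y Z : nat) : fo3 :=
  FAll2 0 2 (fiff (inT X 0) (FOr (inT Y 0) (inT Z 0))).

Definition at2 (t : nat) (a b : term) : fo3 := FAtom2 t 2 [a; b].

Definition singleT (X t : nat) : fo3 :=
  FAll2 0 2 (fiff (inT X 0)
    (FAll1 4 (FAll1 5 (fiff (at2 0 (TVar 4) (TVar 5)) (at2 t (TVar 4) (TVar 5)))))).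

(** The term [k] stands below the binders of variables 4 and 5; shifts are given by a constant or by
    variables 2 and 3 so that nothing is captured. *)
Definition shiftT (X Y : nat) (k : term) : fo3 :=
  FAll2 0 2 (fiff (inT X 0)
    (FEx2 1 2 (FAnd (inT Y 1)
      (FAll1 4 (FAll1 5 (fiff (at2 0 (TVar 4) (TVar 5))
                              (at2 1 (TAdd k (TVar 4)) (TVar 5)))))))).

(** Shifting overwrites variable 0. The copy in variable 1 keeps the original team, from which both
    shifts of a binary temporal operator are counted. *)
Definition save : list opener := [OEx3 1 [2]; OAndC (eqT 1 0)].
Definition move_to (k : term) : list opener := [OEx3 0 [2]; OAndC (shiftT 0 1 k)].

(* Nothing can be written between the two operands of a binary connective. The team variable is
   therefore first set for the second operand, and set again, inside the connective, for the first. *)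
Definition op_neg := [OAll2 1 2; OOrC (FNot (inT 0 1)); ONot; OEx3 0 [2]; OAndC (singleT 0 1)].
Definition op_or := [OEx3 1 [2]; OEx3 2 [2]; OAndC (unionT 0 1 2);
                     OEx3 0 [2]; OAndC (eqT 0 2); OAnd; OEx3 0 [2]; OAndC (eqT 0 1)].
Definition op_X := save ++ move_to TOne.
Definition op_F := save ++ OEx1 2 :: move_to (TVar 2).
Definition op_G := save ++ OAll1 2 :: move_to (TVar 2).
Definition op_U := save ++ OEx1 2 :: move_to (TVar 2) ++
  [OAnd; OAll1 3; OOrC (FLe (TVar 2) (TVar 3))] ++ move_to (TVar 3).
Definition op_R := save ++ OAll1 2 :: move_to (TVar 2) ++
  [OOr; OEx1 3; OAndC (FLe (TAdd (TVar 3) TOne) (TVar 2))] ++ move_to (TVar 3).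

(* An atom arrives in binary, most significant digit first: first-order variable 0 accumulates it. *)
Definition op_atom := [OEx1 0; OAndC (FEq (TVar 0) TZero)].
(** Rebinding variable 0 hides its old value, so the new value is first formed in variable 1 and
    then copied back. *)
Definition op_bit (b : bool) :=
  [OEx1 1; OAndC (FEq (TVar 1) (TAdd (TAdd (TVar 0) (TVar 0)) (if b then TOne else TZero)));
   OEx1 0; OAndC (FEq (TVar 0) (TVar 1))].
Definition atom_end : fo3 := FAll2 0 2 (fimp (inT 0 0) (at2 0 TZero (TVar 0))).

Fixpoint tr_bits (l : list bool) : fo3 :=
  match l with
  | [] => atom_end
  | b :: l' => close (op_bit b) [tr_bits l']
  end.

Fixpoint tr (phi : ltl) : fo3 :=
  match phi with
  | LAtom p => close op_atom [tr_bits (bits p)]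
  | LNeg a => close op_neg [tr a]
  | LAnd a b => close [OAnd] [tr a; tr b]
  | LOr a b => close op_or [tr a; tr b]
  | LX a => close op_X [tr a]
  | LF a => close op_F [tr a]
  | LG a => close op_G [tr a]
  | LU a b => close op_U [tr a; tr b]
  | LR a b => close op_R [tr a; tr b]
  | LTilde a => close [ONot] [tr a]
  end.

(** * The sentences for satisfiability and finite satisfiability *)

Definition op_sat := [OEx3 0 [2]].

(* Worlds are the numbers below variable 6, the root is variable 7; second-order variables 2 and 3
   are the accessibility relation and the labelling, and 4 is the graph of a path. *)
Definition ltw (a b : nat) : fo3 := FLe (TAdd (TVar a) TOne) (TVar b).

Definition wfK : fo3 :=
  FAnd (ltw 7 6)
    (FAll1 4 (fimp (ltw 4 6)
      (FAnd (FEx1 5 (FAnd (ltw 5 6) (at2 2 (TVar 4) (TVar 5))))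
            (FEx1 5 (FAll1 3 (fimp (at2 3 (TVar 4) (TVar 3)) (ltw 3 5))))))).

(** There are no function variables: the first conjunct makes relation 4 the graph of a function.
    The successor is written as [1 + i] so that its value computes to [S i]. *)
Definition pathK : fo3 :=
  FAnd (FAll1 4 (FEx1 5 (FAll1 3 (fiff (at2 4 (TVar 4) (TVar 3)) (FEq (TVar 3) (TVar 5))))))
  (FAnd (at2 4 TZero (TVar 7))
   (FAll1 4 (FAll1 5 (fimp (at2 4 (TVar 4) (TVar 5))
     (FAnd (ltw 5 6)
     (FAnd (FAll1 3 (fimp (at2 4 (TAdd TOne (TVar 4)) (TVar 3)) (at2 2 (TVar 5) (TVar 3))))
           (FAll1 3 (fiff (at2 0 (TVar 4) (TVar 3)) (at2 3 (TVar 5) (TVar 3)))))))))).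

Definition teamK : fo3 := FAll2 0 2 (fiff (inT 0 0) (FEx2 4 2 pathK)).

Definition op_finsat :=
  [OEx1 6; OEx1 7; OEx2 2 2; OEx2 3 2; OAndC wfK; OEx3 0 [2]; OAndC teamK].

Ltac ok_tac :=
  simpl;
  repeat match goal with
  | |- _ /\ _ => split
  | |- Forall _ [] => constructor
  | |- Forall _ (_ :: _) => constructor; simpl
  end; auto 12.

Lemma tr_bits_ok l c1 c2 c3 : In 0 c1 -> In (0, [2]) c3 -> fo3_ok c1 c2 c3 (tr_bits l).
Proof.
  revert c1. induction l as [|b l IH]; intros c1 H1 H3; cbn.
  - ok_tac.
  - destruct b; ok_tac; apply IH; simpl; auto.
Qed.

Lemma tr_ok phi c1 c2 c3 : In (0, [2]) c3 -> fo3_ok c1 c2 c3 (tr phi).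
Proof.
  revert c1 c2 c3; induction phi; intros c1 c2 c3 H; ok_tac;
    first [apply tr_bits_ok | apply IHphi | apply IHphi1 | apply IHphi2]; simpl; auto.
Qed.

Lemma closed_sat phi : fo3_closed (close op_sat [tr phi]).
Proof. apply tr_ok; simpl; auto. Qed.

Lemma closed_finsat phi : fo3_closed (close op_finsat [tr phi]).
Proof. unfold fo3_closed; cbn; ok_tac. apply tr_ok; simpl; auto. Qed.

(** * Traces and teams as relations *)

Definition trel (t : trace) : rel :=
  fun l => match l with [i; p] => t i p = true | _ => False end.

Definition trel3 (T : team) : rel3 := fun Rs => exists t, T t /\ Rs = [trel t].

(** Traces are boolean whereas relations are propositional; excluded middle in informative form
    makes every binary relation come from a trace. *)
Definition brel (f : nat -> nat -> Prop) : nat -> nat -> bool :=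
  fun i p => if excluded_middle_informative (f i p) then true else false.

Lemma brel_true f i p : brel f i p = true <-> f i p.
Proof. unfold brel. destruct excluded_middle_informative; split; auto; discriminate. Qed.

Lemma trel_arity t : rel_of_arity 2 (trel t).
Proof. intros [|? [|? [|]]]; simpl; tauto. Qed.

Lemma trel_surj R : rel_of_arity 2 R -> exists t, R = trel t.
Proof.
  intro H. exists (brel (fun i p => R [i; p])).
  apply functional_extensionality; intro l. apply propositional_extensionality.
  pose proof (H l) as Hl.
  destruct l as [|i [|p [|]]]; simpl; try (split; [intro K; apply Hl in K; discriminate|tauto]).
  symmetry; apply brel_true.
Qed.

Lemma trace_ext (t u : trace) : (forall i p, t i p = true <-> u i p = true) -> t = u.
Proof.
  intro H. apply functional_extensionality; intro i. apply functional_extensionality; intro p.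
  apply eq_true_iff_eq, H.
Qed.

Lemma trel_inj t u : trel t = trel u -> t = u.
Proof.
  intro H. apply trace_ext. intros i p.
  change (trel t [i; p] <-> trel u [i; p]). rewrite H. tauto.
Qed.

Lemma trel3_in T t : trel3 T [trel t] <-> T t.
Proof.
  split.
  - intros [u [H E]]. injection E as E. apply trel_inj in E. subst; auto.
  - intro H; exists t; auto.
Qed.

Lemma trel3_type T : rel3_of_type [2] (trel3 T).
Proof. intros Rs [t [_ ->]]. repeat constructor. apply trel_arity. Qed.

Lemma trel3_surj a : rel3_of_type [2] a -> exists T, a = trel3 T.
Proof.
  intro H. exists (fun t => a [trel t]).
  apply functional_extensionality; intro Rs. apply propositional_extensionality. split.
  - intro K. pose proof (H _ K) as F. inversion F as [|x R xs l HR HF]; subst.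
    inversion HF; subst. destruct (trel_surj R HR) as [t ->]. exists t; auto.
  - intros [t [K ->]]; exact K.
Qed.

Lemma team_ext (T U : team) : (forall t, T t <-> U t) -> T = U.
Proof.
  intro H. apply functional_extensionality; intro t. apply propositional_extensionality, H.
Qed.

Lemma ex_trace (P : rel -> Prop) :
  (exists R, rel_of_arity 2 R /\ P R) <-> exists t, P (trel t).
Proof.
  split.
  - intros [R [H K]]. destruct (trel_surj R H) as [t ->]; eauto.
  - intros [t K]. exists (trel t); auto using trel_arity.
Qed.

Lemma all_trace (P : rel -> Prop) :
  (forall R, rel_of_arity 2 R -> P R) <-> forall t, P (trel t).
Proof.
  split; intro H; [auto using trel_arity|].
  intros R HR. destruct (trel_surj R HR) as [t ->]; auto.
Qed.

Lemma ex_team (P : rel3 -> Prop) :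
  (exists a, rel3_of_type [2] a /\ P a) <-> exists T, P (trel3 T).
Proof.
  split.
  - intros [R [H K]]. destruct (trel3_surj R H) as [t ->]; eauto.
  - intros [t K]. exists (trel3 t); auto using trel3_type.
Qed.

Lemma ex_iff {X : Type} (P Q : X -> Prop) :
  (forall x, P x <-> Q x) -> (exists x, P x) <-> (exists x, Q x).
Proof. intro H; split; intros [x K]; exists x; apply H, K. Qed.

Lemma all_iff {X : Type} (P Q : X -> Prop) :
  (forall x, P x <-> Q x) -> (forall x, P x) <-> (forall x, Q x).
Proof. intro H; split; intros K x; apply H, K. Qed.

Lemma and_iff (A B C D : Prop) : (A <-> B) -> (C <-> D) -> (A /\ C <-> B /\ D).
Proof. tauto. Qed.

Lemma or_iff (A B C D : Prop) : (A <-> B) -> (C <-> D) -> (A \/ C <-> B \/ D).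
Proof. tauto. Qed.

Lemma imp_iff_compat (A B C D : Prop) : (A <-> B) -> (C <-> D) -> ((A -> C) <-> (B -> D)).
Proof. tauto. Qed.

Lemma iff_iff_compat (A B C D : Prop) : (A <-> B) -> (C <-> D) -> ((A <-> C) <-> (B <-> D)).
Proof. tauto. Qed.

Lemma ex_eq_and {X : Type} (a : X) (P : X -> Prop) : (exists x, x = a /\ P x) <-> P a.
Proof. split; [intros [x [-> K]]; exact K | eauto]. Qed.

(** * Correctness of the translation *)

Lemma holds_and s1 s2 s3 f g :
  fo3_holds s1 s2 s3 (FAnd f g) <-> fo3_holds s1 s2 s3 f /\ fo3_holds s1 s2 s3 g.
Proof. reflexivity. Qed.

Lemma holds_ex1 s1 s2 s3 i f :
  fo3_holds s1 s2 s3 (FEx1 i f) <-> exists v, fo3_holds (upd1 s1 i v) s2 s3 f.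
Proof. reflexivity. Qed.

Lemma holds_all1 s1 s2 s3 i f :
  fo3_holds s1 s2 s3 (FAll1 i f) <-> forall v, fo3_holds (upd1 s1 i v) s2 s3 f.
Proof. reflexivity. Qed.

Lemma holds_or s1 s2 s3 f g :
  fo3_holds s1 s2 s3 (FOr f g) <-> fo3_holds s1 s2 s3 f \/ fo3_holds s1 s2 s3 g.
Proof. reflexivity. Qed.

Lemma holds_fimp s1 s2 s3 f g :
  fo3_holds s1 s2 s3 (fimp f g) <-> (fo3_holds s1 s2 s3 f -> fo3_holds s1 s2 s3 g).
Proof. simpl. split; [tauto | apply imply_to_or]. Qed.

Lemma holds_fiff s1 s2 s3 f g :
  fo3_holds s1 s2 s3 (fiff f g) <-> (fo3_holds s1 s2 s3 f <-> fo3_holds s1 s2 s3 g).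
Proof. unfold fiff. cbn [fo3_holds]. rewrite !holds_fimp. tauto. Qed.

Lemma holds_inT s1 s2 s3 X x T t :
  s3 X [2] = trel3 T -> s2 x 2 = trel t -> fo3_holds s1 s2 s3 (inT X x) <-> T t.
Proof. simpl. intros -> ->. apply trel3_in. Qed.

Lemma holds_eqT s1 s2 s3 X Y T U :
  s3 X [2] = trel3 T -> s3 Y [2] = trel3 U ->
  fo3_holds s1 s2 s3 (eqT X Y) <-> T = U.
Proof.
  intros HX HY. unfold eqT. cbn [fo3_holds]. rewrite all_trace.
  transitivity (forall t, T t <-> U t).
  - apply all_iff; intro t. rewrite holds_fiff.
    rewrite (holds_inT _ _ _ _ _ T t), (holds_inT _ _ _ _ _ U t); auto; reflexivity.
  - split; [apply team_ext | intros ->; tauto].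
Qed.

Lemma holds_unionT s1 s2 s3 X Y Z T U V :
  s3 X [2] = trel3 T -> s3 Y [2] = trel3 U -> s3 Z [2] = trel3 V ->
  fo3_holds s1 s2 s3 (unionT X Y Z) <-> (forall t, T t <-> (U t \/ V t)).
Proof.
  intros HX HY HZ. unfold unionT. cbn [fo3_holds]. rewrite all_trace.
  apply all_iff; intro t. rewrite holds_fiff. cbn [fo3_holds].
  rewrite (holds_inT _ _ _ _ _ T t), (holds_inT _ _ _ _ _ U t), (holds_inT _ _ _ _ _ V t);
    auto; reflexivity.
Qed.

Lemma holds_singleT s1 s2 s3 T t :
  s3 0 [2] = trel3 T -> s2 1 2 = trel t ->
  fo3_holds s1 s2 s3 (singleT 0 1) <-> T = tsingleton t.
Proof.
  intros HX Ht. unfold singleT. cbn [fo3_holds]. rewrite all_trace.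
  transitivity (forall u, T u <-> u = t).
  - apply all_iff; intro u. rewrite holds_fiff.
    rewrite (holds_inT _ _ _ _ _ T u); auto.
    assert (E : fo3_holds s1 (upd2 s2 0 2 (trel u)) s3
       (FAll1 4 (FAll1 5 (fiff (at2 0 (TVar 4) (TVar 5)) (at2 1 (TVar 4) (TVar 5))))) <-> u = t).
    { cbn [fo3_holds]. transitivity (forall i p, u i p = true <-> t i p = true).
      - apply all_iff; intro i. apply all_iff; intro p. rewrite holds_fiff. cbn.
        rewrite Ht. reflexivity.
      - split; [apply trace_ext | intros ->; tauto]. }
    rewrite E. reflexivity.
  - split; [apply team_ext | intros ->; unfold tsingleton; tauto].
Qed.

Lemma holds_shiftT s1 s2 s3 X Y T U tm k :
  s3 X [2] = trel3 T -> s3 Y [2] = trel3 U ->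
  (forall i p, teval (upd1 (upd1 s1 4 i) 5 p) tm = k) ->
  fo3_holds s1 s2 s3 (shiftT X Y tm) <-> T = tshift k U.
Proof.
  intros HX HY Hk. unfold shiftT. cbn [fo3_holds]. rewrite all_trace.
  transitivity (forall u, T u <-> tshift k U u).
  - apply all_iff; intro u. rewrite holds_fiff.
    rewrite (holds_inT _ _ _ _ _ T u); auto.
    cbn [fo3_holds]. rewrite ex_trace. unfold tshift.
    assert (E : forall t, fo3_holds s1 (upd2 (upd2 s2 0 2 (trel u)) 1 2 (trel t)) s3
       (FAnd (inT Y 1) (FAll1 4 (FAll1 5 (fiff (at2 0 (TVar 4) (TVar 5))
                              (at2 1 (TAdd tm (TVar 4)) (TVar 5))))))
       <-> U t /\ u = (fun i => t (k + i))).
    { intro t. cbn [fo3_holds]. rewrite (holds_inT _ _ _ _ _ U t); auto.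
      apply and_iff_compat_l.
      transitivity (forall i p, u i p = true <-> t (k + i) p = true).
      - apply all_iff; intro i. apply all_iff; intro p. rewrite holds_fiff.
        cbn -[teval]. cbn [teval]. rewrite Hk. reflexivity.
      - split; [apply (trace_ext u (fun i => t (k + i))) | intros ->; tauto]. }
    cbn [fo3_holds] in E. setoid_rewrite E. reflexivity.
  - split; [apply team_ext | intros ->; tauto].
Qed.

(** When [F] pins variable [X] down to a single team, an existential quantifier over [X] guarded by
    [F] works as an assignment. All rebindings of the team variable are of this kind. *)
Definition sets (F : fo3) (s1 : nat -> nat) (s2 : nat -> nat -> rel)
  (s3 : nat -> list nat -> rel3) (X : nat) (T : team) : Prop :=
  forall U, fo3_holds s1 s2 (upd3 s3 X [2] (trel3 U)) F <-> U = T.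

Lemma holds_set F s1 s2 s3 X T g : sets F s1 s2 s3 X T ->
  fo3_holds s1 s2 s3 (FEx3 X [2] (FAnd F g)) <->
  fo3_holds s1 s2 (upd3 s3 X [2] (trel3 T)) g.
Proof.
  intro H. cbn [fo3_holds]. rewrite ex_team.
  transitivity (exists U, U = T /\ fo3_holds s1 s2 (upd3 s3 X [2] (trel3 U)) g).
  - apply ex_iff; intro U. rewrite (H U). reflexivity.
  - apply (ex_eq_and T (fun U => fo3_holds s1 s2 (upd3 s3 X [2] (trel3 U)) g)).
Qed.

Lemma holds_save s1 s2 s3 T g : s3 0 [2] = trel3 T ->
  fo3_holds s1 s2 s3 (FEx3 1 [2] (FAnd (eqT 1 0) g)) <->
  fo3_holds s1 s2 (upd3 s3 1 [2] (trel3 T)) g.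
Proof.
  intro H. apply holds_set. intro U. apply holds_eqT; [reflexivity | exact H].
Qed.

Lemma holds_move_to s1 s2 s3 T tm k g :
  s3 1 [2] = trel3 T -> (forall i p, teval (upd1 (upd1 s1 4 i) 5 p) tm = k) ->
  fo3_holds s1 s2 s3 (FEx3 0 [2] (FAnd (shiftT 0 1 tm) g)) <->
  fo3_holds s1 s2 (upd3 s3 0 [2] (trel3 (tshift k T))) g.
Proof.
  intros H Hk. apply holds_set. intro U. apply holds_shiftT; [reflexivity | exact H | exact Hk].
Qed.

(** * Numerals, and correctness by induction on the formula *)

Definition bits_val (x : nat) (l : list bool) : nat :=
  fold_left (fun x b => 2 * x + Nat.b2n b) l x.

Lemma bits_double n b : 0 < n -> bits (2 * n + Nat.b2n b) = bits n ++ [b].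
Proof.
  intro Hn. unfold bits.
  replace (Nat.log2 (2 * n + Nat.b2n b)) with (S (Nat.log2 n)).
  - change (seq 0 (S (S (Nat.log2 n)))) with (0 :: seq 1 (S (Nat.log2 n))).
    rewrite <- seq_shift. cbn [rev]. rewrite <- map_rev, map_app. f_equal.
    + rewrite map_map. apply map_ext; intro i. apply Nat.testbit_succ_r.
    + cbn [map]. rewrite Nat.testbit_0_r. reflexivity.
  - destruct b; cbn [Nat.b2n].
    + rewrite Nat.log2_succ_double; lia.
    + rewrite Nat.add_0_r, Nat.log2_double; lia.
Qed.

Lemma bits_val_bits n : bits_val 0 (bits n) = n.
Proof.
  induction n as [n IH] using lt_wf_ind.
  (* Halving a number up to 1 gives 0, whose numeral is [[false]] and not empty, so appending a
     digit to it would leave a leading zero. *)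
  destruct (le_lt_dec n 1) as [H|H].
  - destruct n as [|[|]]; [reflexivity | reflexivity | lia].
  - pose proof (Nat.div2_odd n) as E. set (m := Nat.div2 n) in *.
    assert (0 < m < n) by (destruct (Nat.odd n); simpl in E; lia).
    rewrite E. rewrite bits_double by lia.
    unfold bits_val in *. rewrite fold_left_app, IH by lia. reflexivity.
Qed.

Lemma holds_tr_bits l s1 s2 s3 T : s3 0 [2] = trel3 T ->
  fo3_holds s1 s2 s3 (tr_bits l) <-> forall t, T t -> t 0 (bits_val (s1 0) l) = true.
Proof.
  intro H. revert s1. induction l as [|b l IH]; intro s1.
  - unfold tr_bits, atom_end. cbn [fo3_holds]. rewrite all_trace. apply all_iff; intro t.
    rewrite holds_fimp, (holds_inT _ _ _ _ _ T t); auto. reflexivity.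
  - cbn -[bits_val fo3_holds]. cbn [fo3_holds].
    (* This is the value forced on variable 1; the second one-point step below copies it to variable
       0. *)
    rewrite <- (ex_eq_and (2 * s1 0 + Nat.b2n b)
       (fun x => forall t, T t -> t 0 (bits_val x l) = true)).
    apply ex_iff; intro y.
    apply and_iff.
    + cbn. destruct b; cbn; lia.
    + rewrite <- (ex_eq_and y (fun x => forall t, T t -> t 0 (bits_val x l) = true)).
      apply ex_iff; intro x. apply and_iff; [reflexivity | apply IH].
Qed.

(** The assignments are arbitrary apart from the team variable 0. Hence the induction hypotheses
    apply under any of the rebindings made by the enclosing connectives. *)
Lemma tr_correct phi s1 s2 s3 T : s3 0 [2] = trel3 T ->
  fo3_holds s1 s2 s3 (tr phi) <-> tsat T phi.
Proof.
  revert s1 s2 s3 T; induction phi; intros s1 s2 s3 T H;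
    cbn [tr tsat].
  - replace (forall t, T t -> t 0 n = true)
      with (forall t, T t -> t 0 (bits_val 0 (bits n)) = true)
      by (rewrite bits_val_bits; reflexivity).
    rewrite <- (ex_eq_and 0 (fun x => forall t, T t -> t 0 (bits_val x (bits n)) = true)).
    apply ex_iff; intro x. apply and_iff; [reflexivity|].
    apply holds_tr_bits; exact H.
  - cbn -[tr fo3_holds inT singleT]. cbn [fo3_holds]. rewrite all_trace.
    apply all_iff; intro t.
    set (s2' := upd2 s2 1 2 (trel t)).
    change ((fo3_holds s1 s2' s3
       (fimp (inT 0 1) (FNot (FEx3 0 [2] (FAnd (singleT 0 1) (tr phi)))))) <-> 
       (T t -> ~ tsat (tsingleton t) phi)).
    rewrite holds_fimp, (holds_inT _ _ _ _ _ T t); auto.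
    change (fo3_holds s1 s2' s3 (FNot (FEx3 0 [2] (FAnd (singleT 0 1) (tr phi))))) with
      (~ fo3_holds s1 s2' s3 (FEx3 0 [2] (FAnd (singleT 0 1) (tr phi)))).
    rewrite (holds_set _ _ _ _ _ (tsingleton t)).
    + rewrite (IHphi _ _ _ (tsingleton t)); reflexivity.
    + intro U. apply holds_singleT; reflexivity.
  - cbn -[tr]. rewrite (IHphi1 _ _ _ T), (IHphi2 _ _ _ T); auto; reflexivity.
  - cbn -[tr fo3_holds unionT eqT]. cbn [fo3_holds]. rewrite ex_team.
    apply ex_iff; intro S. rewrite ex_team. apply ex_iff; intro U.
    set (s3' := upd3 (upd3 s3 1 [2] (trel3 S)) 2 [2] (trel3 U)).
    apply and_iff; [apply holds_unionT; auto|].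
    change (fo3_holds s1 s2 s3' (FEx3 0 [2] (FAnd (eqT 0 2)
       (FAnd (FEx3 0 [2] (FAnd (eqT 0 1) (tr phi1))) (tr phi2)))) <-> tsat S phi1 /\ tsat U phi2).
    rewrite (holds_set _ _ _ _ _ U) by (intro; apply holds_eqT; reflexivity).
    cbn [fo3_holds]. apply and_iff; [|apply IHphi2; reflexivity].
    change (fo3_holds s1 s2 (upd3 s3' 0 [2] (trel3 U)) (FEx3 0 [2] (FAnd (eqT 0 1) (tr phi1)))
            <-> tsat S phi1).
    rewrite (holds_set _ _ _ _ _ S) by (intro; apply holds_eqT; reflexivity).
    apply IHphi1; reflexivity.
  - cbn -[tr fo3_holds shiftT eqT].
    rewrite (holds_save _ _ _ T) by exact H.
    rewrite (holds_move_to _ _ _ T _ 1) by reflexivity.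
    apply IHphi; reflexivity.
  - cbn -[tr fo3_holds shiftT eqT].
    rewrite (holds_save _ _ _ T) by exact H.
    rewrite holds_ex1. apply ex_iff; intro k.
    rewrite (holds_move_to _ _ _ T _ k) by reflexivity.
    apply IHphi; reflexivity.
  - cbn -[tr fo3_holds shiftT eqT].
    rewrite (holds_save _ _ _ T) by exact H.
    rewrite holds_all1. apply all_iff; intro k.
    rewrite (holds_move_to _ _ _ T _ k) by reflexivity.
    apply IHphi; reflexivity.
  - cbn -[tr fo3_holds shiftT eqT].
    rewrite (holds_save _ _ _ T) by exact H.
    rewrite holds_ex1. apply ex_iff; intro k.
    rewrite (holds_move_to _ _ _ T _ k) by reflexivity.
    set (s1' := upd1 s1 2 k). set (s3' := upd3 _ 0 [2] _).
    (* In prefix notation the first operand of the until comes first, hence its conjunct does too,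
       opposite to the order in [tsat]. *)
    rewrite (and_comm (tsat _ _)), holds_and.
    apply and_iff; [|apply IHphi2; reflexivity].
    apply all_iff; intro j.
    change (k <= j \/ fo3_holds (upd1 s1' 3 j) s2 s3' (FEx3 0 [2]
      (FAnd (shiftT 0 1 (TVar 3)) (tr phi1))) <-> (j < k -> tsat (tshift j T) phi1)).
    (* Variable 1 still holds [T], so the shift by [j] starts from the original team and not from
       [tshift k T]. *)
    rewrite (holds_move_to _ _ _ T _ j) by reflexivity.
    rewrite (IHphi1 _ _ _ (tshift j T)) by reflexivity.
    split; [intros [?|?] ?; [lia | assumption] |].
    intro K. destruct (le_lt_dec k j); auto.
  - cbn -[tr fo3_holds shiftT eqT].
    rewrite (holds_save _ _ _ T) by exact H.
    rewrite holds_all1. apply all_iff; intro k.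
    rewrite (holds_move_to _ _ _ T _ k) by reflexivity.
    set (s1' := upd1 s1 2 k). set (s3' := upd3 _ 0 [2] _).
    rewrite (or_comm (tsat _ _)), holds_or.
    apply or_iff; [|apply IHphi2; reflexivity].
    apply ex_iff; intro j.
    change (j + 1 <= k /\ fo3_holds (upd1 s1' 3 j) s2 s3' (FEx3 0 [2]
      (FAnd (shiftT 0 1 (TVar 3)) (tr phi1))) <-> j < k /\ tsat (tshift j T) phi1).
    rewrite (holds_move_to _ _ _ T _ j) by reflexivity.
    rewrite (IHphi1 _ _ _ (tshift j T)) by reflexivity.
    apply and_iff; [lia | reflexivity].
  - cbn -[tr]. rewrite (IHphi _ _ _ T); auto; reflexivity.
Qed.

Lemma sat_correct phi : Delta30 (close op_sat [tr phi]) <-> ltl_satisfiable phi.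
Proof.
  unfold Delta30, ltl_satisfiable.
  pose proof (closed_sat phi) as Hc.
  transitivity (fo3_holds (fun _ => 0) (fun _ _ _ => False) (fun _ _ _ => False)
    (FEx3 0 [2] (tr phi))); [change (close op_sat [tr phi]) with (FEx3 0 [2] (tr phi)) in *; tauto|].
  cbn [fo3_holds]. rewrite ex_team. apply ex_iff; intro T. apply tr_correct; reflexivity.
Qed.

(** * Kripke structures and their teams *)

Lemma holds_wfK s1 s2 s3 n r R E :
  s1 6 = n -> s1 7 = r -> s2 2 2 = trel R -> s2 3 2 = trel E ->
  fo3_holds s1 s2 s3 wfK <-> kripke_wf (Kripke n R E r).
Proof.
  intros H6 H7 H2 H3. unfold wfK, kripke_wf. rewrite holds_and. cbn [kn kR keta kroot].
  apply and_iff.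
  { simpl. rewrite H6, H7. lia. }
  transitivity (forall w, w < n ->
    (exists v, v < n /\ R w v = true) /\ (exists b, forall p, E w p = true -> p < b)).
  - rewrite holds_all1. apply all_iff; intro w. rewrite holds_fimp, holds_and.
    assert (Ew : fo3_holds (upd1 s1 4 w) s2 s3 (ltw 4 6) <-> w < n).
    { simpl. unfold upd1; simpl. rewrite H6. lia. }
    rewrite Ew. apply all_iff; intros _. apply and_iff; rewrite holds_ex1; apply ex_iff.
    + intro v. rewrite holds_and. apply and_iff; simpl; unfold upd1; simpl.
      * rewrite H6. lia.
      * rewrite H2. reflexivity.
    + intro b. rewrite holds_all1. apply all_iff; intro p. rewrite holds_fimp. simpl. rewrite H3. unfold upd1; simpl.
      rewrite Nat.add_1_r. reflexivity.
  - firstorder.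
Qed.

Lemma holds_pathK s1 s2 s3 K R t :
  s1 6 = kn K -> s1 7 = kroot K -> s2 2 2 = trel (kR K) -> s2 3 2 = trel (keta K) ->
  s2 0 2 = trel t -> s2 4 2 = trel R ->
  fo3_holds s1 s2 s3 pathK <->
  (forall i, exists v, forall x, R i x = true <-> x = v) /\ R 0 (kroot K) = true /\
  (forall i v, R i v = true -> v < kn K /\ (forall v', R (S i) v' = true -> kR K v v' = true) /\
               (forall p, t i p = true <-> keta K v p = true)).
Proof.
  intros H6 H7 H2 H3 H0 H4. unfold pathK. rewrite !holds_and.
  apply and_iff; [|apply and_iff].
  - rewrite holds_all1. apply all_iff; intro i. rewrite holds_ex1. apply ex_iff; intro v. rewrite holds_all1. apply all_iff; intro x.
    rewrite holds_fiff. simpl. rewrite H4. reflexivity.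
  - simpl. rewrite H4, H7. reflexivity.
  - rewrite holds_all1. apply all_iff; intro i. rewrite holds_all1. apply all_iff; intro v. rewrite holds_fimp, !holds_and.
    apply imp_iff_compat.
    + simpl. rewrite H4. reflexivity.
    + apply and_iff; [|apply and_iff].
      * simpl. unfold upd1; simpl. rewrite H6. lia.
      * rewrite holds_all1. apply all_iff; intro v'. rewrite holds_fimp. simpl. rewrite H4, H2. reflexivity.
      * rewrite holds_all1. apply all_iff; intro p. rewrite holds_fiff. simpl. rewrite H0, H3. reflexivity.
Qed.

(** Choice recovers a path from its functional graph. The graph is a boolean relation on numbers and
    so has the type [trace], which lets [ex_trace] treat its quantifier as well. *)
Lemma kteam_graph K t :
  kteam K t <-> exists R : trace,
  (forall i, exists v, forall x, R i x = true <-> x = v) /\ R 0 (kroot K) = true /\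
  (forall i v, R i v = true -> v < kn K /\ (forall v', R (S i) v' = true -> kR K v v' = true) /\
               (forall p, t i p = true <-> keta K v p = true)).
Proof.
  split.
  - intros [pi [[Hr Hp] ->]]. exists (fun i v => Nat.eqb v (pi i)).
    repeat split.
    + intro i. exists (pi i). intro x. apply Nat.eqb_eq.
    + apply Nat.eqb_eq. auto.
    + apply Nat.eqb_eq in H as ->. apply Hp.
    + apply Nat.eqb_eq in H as ->. intros v' H. apply Nat.eqb_eq in H as ->. apply Hp.
    + apply Nat.eqb_eq in H as ->. auto.
    + apply Nat.eqb_eq in H as ->. auto.
  - intros [R [Hf [Hr Hs]]].
    set (pi := fun i => proj1_sig (constructive_indefinite_description _ (Hf i))).
    assert (Hpi : forall i x, R i x = true <-> x = pi i).
    { intro i. unfold pi. destruct (constructive_indefinite_description _ (Hf i)); auto. }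
    assert (HR : forall i, R i (pi i) = true) by (intro; apply Hpi; reflexivity).
    exists pi. repeat split.
    + symmetry. apply Hpi, Hr.
    + apply (Hs i), HR.
    + apply (Hs i), HR. apply HR.
    + apply trace_ext. intros i. apply (Hs i), HR.
Qed.

Lemma finsat_correct phi : Delta30 (close op_finsat [tr phi]) <-> ltl_fin_satisfiable phi.
Proof.
  unfold Delta30, ltl_fin_satisfiable.
  pose proof (closed_finsat phi) as Hc.
  transitivity (fo3_holds (fun _ => 0) (fun _ _ _ => False) (fun _ _ _ => False)
    (close op_finsat [tr phi])); [tauto|].
  transitivity (exists n r R E, kripke_wf (Kripke n R E r) /\
                                tsat (kteam (Kripke n R E r)) phi).
  - cbn -[tr fo3_holds teamK wfK].
    apply ex_iff; intro n. apply ex_iff; intro r.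
    cbn [fo3_holds].
    rewrite ex_trace. apply ex_iff; intro R. rewrite ex_trace. apply ex_iff; intro E.
    set (s1 := upd1 _ 7 r). set (s2 := upd2 _ 3 2 _).
    apply and_iff; [apply holds_wfK; reflexivity|].
    change (fo3_holds s1 s2 (fun _ _ _ => False) (FEx3 0 [2] (FAnd teamK (tr phi))) <->
            tsat (kteam (Kripke n R E r)) phi).
    rewrite (holds_set _ _ _ _ _ (kteam (Kripke n R E r))).
    + apply tr_correct; reflexivity.
    + intro U. unfold teamK. cbn [fo3_holds]. rewrite all_trace.
      transitivity (forall t, U t <-> kteam (Kripke n R E r) t).
      * apply all_iff; intro t. rewrite holds_fiff.
        rewrite (holds_inT _ _ _ _ _ U t), kteam_graph; try reflexivity.
        cbn [fo3_holds]. rewrite ex_trace.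
        apply iff_iff_compat; [reflexivity|]. apply ex_iff; intro P.
        apply holds_pathK; reflexivity.
      * split; [apply team_ext | intros ->; tauto].
  - split.
    + intros [n [r [R [E H]]]]. eauto.
    + intros [[n R E r] H]. eauto.
Qed.

(** * The reduction *)

(* Expected input: a formula; the first digit of a number; its end mark after a leading zero;
   a further digit or the end mark. *)
Inductive mode := MForm | MNum0 | MZero | MNum1.

(** The bits of the current token read so far; the fifth bit completes it and is acted upon at
    once. *)
Inductive buffer :=
| B0
| B1 (a : bool)
| B2 (a b : bool)
| B3 (a b c : bool)
| B4 (a b c d : bool).

Inductive rstate := Reading (m : mode) (u : buffer) | Sink.

Definition node_openers (k : nat) : option (list opener) :=
  match k with
  | 4 => Some op_neg
  | 5 => Some [OAnd]
  | 6 => Some op_or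
  | 7 => Some op_X
  | 8 => Some op_F
  | 9 => Some op_G
  | 10 => Some op_U
  | 11 => Some op_R
  | 12 => Some [ONot]
  | _ => None
  end.

(** After a leading zero only the end mark is accepted: a padded numeral encodes no atom, yet its
    digits would build a well-formed formula. *)
Definition act (m : mode) (k : nat) : option (list bool * mode) :=
  match m, k with
  | MForm, 3 => Some (flat_map enc_opener op_atom, MNum0)
  | MForm, _ => option_map (fun os => (flat_map enc_opener os, MForm)) (node_openers k)
  | MNum0, 0 => Some (flat_map enc_opener (op_bit false), MZero)
  | MNum0, 1 => Some (flat_map enc_opener (op_bit true), MNum1)
  | MNum1, 0 => Some (flat_map enc_opener (op_bit false), MNum1)
  | MNum1, 1 => Some (flat_map enc_opener (op_bit true), MNum1)
  | MNum1, 2 | MZero, 2 => Some (enc_fo3 atom_end, MForm)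
  | _, _ => None
  end.

(* 31 is the code of no symbol, so writing it makes the output ill-formed. *)
Definition error : list bool := tok 31.

Definition tokval (a b c d e : bool) : nat :=
  16 * Nat.b2n a + 8 * Nat.b2n b + 4 * Nat.b2n c + 2 * Nat.b2n d + Nat.b2n e.

Definition rnext (q : rstate) (e : bool) : rstate :=
  match q with
  | Reading m B0 => Reading m (B1 e)
  | Reading m (B1 a) => Reading m (B2 a e)
  | Reading m (B2 a b) => Reading m (B3 a b e)
  | Reading m (B3 a b c) => Reading m (B4 a b c e)
  | Reading m (B4 a b c d) =>
      match act m (tokval a b c d e) with
      | Some (_, m') => Reading m' B0
      | None => Sink
      end
  | Sink => Sink
  end.

Definition rout (q : rstate) (e : bool) : list bool :=
  match q with
  | Reading m (B4 a b c d) =>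
      match act m (tokval a b c d e) with
      | Some (o, _) => o
      | None => error
      end
  | _ => []
  end.

(** Input that breaks off inside a token or a numeral is marked here; in [Sink] the error has been
    written already. Missing operands are missing from the output too. *)
Definition rfinish (q : rstate) : list bool :=
  match q with
  | Sink | Reading MForm B0 => []
  | _ => error
  end.

Definition rstates : list rstate :=
  let bs := [true; false] in
  Sink :: flat_map (fun m =>
    Reading m B0 :: flat_map (fun a =>
      Reading m (B1 a) :: flat_map (fun b =>
        Reading m (B2 a b) :: flat_map (fun c =>
          Reading m (B3 a b c) :: map (fun d => Reading m (B4 a b c d)) bs) bs) bs) bs)
    [MForm; MNum0; MZero; MNum1].

Lemma rstates_finite q : In q rstates.
Proof.
  destruct q as [[] [|[]|[] []|[] [] []|[] [] [] []]|];
    repeat first [left; reflexivity | right].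
Qed.

Definition reduction (os : list opener) : transducer :=
  Build_transducer rstate rstates rstates_finite (Reading MForm B0)
    (flat_map enc_opener os) rnext rout rfinish.

(** * Runs of the reduction on well-formed and ill-formed input *)

Definition read (os : list opener) (m : mode) (w : list bool) : list bool :=
  td_run (reduction os) (Reading m B0) w.

Lemma run_sink os w : td_run (reduction os) Sink w = [].
Proof. induction w; simpl; auto. Qed.

Lemma tokval_tok k : k < 32 ->
  tokval (Nat.testbit k 4) (Nat.testbit k 3) (Nat.testbit k 2) (Nat.testbit k 1)
         (Nat.testbit k 0) = k.
Proof. intro H. do 32 (destruct k as [|k]; [reflexivity|]). lia. Qed.

Lemma read_tok os m k w : k < 32 ->
  read os m (tok k ++ w) =
  match act m k with Some (o, m') => o ++ read os m' w | None => error end.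
Proof.
  intro H. unfold read, tok. cbn [map app td_run td_out td_next reduction rout rnext].
  rewrite (tokval_tok k H). destruct (act m k) as [[o m']|]; [reflexivity|].
  rewrite run_sink. apply app_nil_r.
Qed.

Lemma read_cases os w :
  w = [] \/ (exists k v, k < 32 /\ w = tok k ++ v) \/ forall m, read os m w = error.
Proof.
  destruct w as [|a [|b [|c [|d [|e w]]]]]; auto;
    try (right; right; intros []; reflexivity).
  right; left. exists (tokval a b c d e), w.
  destruct a, b, c, d, e; split; try reflexivity; cbn; lia.
Qed.

(** The sink writes nothing, so once the output before an error is stripped off, exactly [error] is
    left. Formulas start with tokens 18 to 30. *)
Lemma error_ill_formed fs : error = flat_map enc_fo3 fs -> False.
Proof.
  unfold error. destruct fs as [|f fs]; [discriminate|].
  cbn [flat_map]. destruct (enc_fo3_head f) as [k [s [Hk ->]]].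
  rewrite <- (app_nil_r (tok 31)), <- app_assoc. intro H. apply tok_app_inj in H; lia.
Qed.

Lemma bits_shape n : bits n = [false] \/ exists l, bits n = true :: l.
Proof.
  destruct n as [|n]; [left; reflexivity | right].
  unfold bits. rewrite seq_S, rev_app_distr. cbn [rev app map Nat.add].
  rewrite Nat.bit_log2 by lia. eauto.
Qed.

(** Appending a digit doubles the number, hence the induction from the right. With [bits_shape] this
    shows that the accepted digit strings are precisely the numerals. *)
Lemma bits_of_digits l : exists n, 0 < n /\ bits n = true :: l.
Proof.
  induction l as [|b l [n [Hn E]]] using rev_ind.
  - exists 1. split; [lia | reflexivity].
  - exists (2 * n + Nat.b2n b). split; [lia|]. rewrite bits_double, E by exact Hn. reflexivity.
Qed.

Definition enc_digits (l : list bool) : list bool :=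
  flat_map (fun b : bool => tok (if b then 1 else 0)) l.

Lemma enc_close1 os f : arity os = 1 ->
  enc_fo3 (close os [f]) = flat_map enc_opener os ++ enc_fo3 f.
Proof. intro H. rewrite enc_close by auto. cbn [flat_map]. rewrite app_nil_r. reflexivity. Qed.

Lemma enc_close2 os f g : arity os = 2 ->
  enc_fo3 (close os [f; g]) = flat_map enc_opener os ++ enc_fo3 f ++ enc_fo3 g.
Proof. intro H. rewrite enc_close by auto. cbn [flat_map]. rewrite app_nil_r. reflexivity. Qed.

Lemma read_digits os l w :
  read os MNum1 (enc_digits l ++ tok 2 ++ w) = enc_fo3 (tr_bits l) ++ read os MForm w.
Proof.
  induction l as [|b l IH]; cbn [enc_digits flat_map tr_bits].
  - rewrite app_nil_l. rewrite read_tok by lia. reflexivity.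
  - rewrite <- app_assoc. rewrite read_tok by (destruct b; lia).
    rewrite enc_close1 by reflexivity. rewrite <- app_assoc.
    replace (act MNum1 (if b then 1 else 0)) with (Some (flat_map enc_opener (op_bit b), MNum1))
      by (destruct b; reflexivity).
    fold (enc_digits l). rewrite IH. reflexivity.
Qed.

Lemma read_ltl os phi w :
  read os MForm (enc_ltl phi ++ w) = enc_fo3 (tr phi) ++ read os MForm w.
Proof.
  revert w; induction phi; intro w; cbn [enc_ltl tr]; rewrite <- ?app_assoc;
    rewrite read_tok by lia;
    try (cbn [act node_openers option_map];
         rewrite ?enc_close1, ?enc_close2 by reflexivity; rewrite <- ?app_assoc;
         rewrite ?IHphi, ?IHphi1, ?IHphi2; reflexivity).
  cbn [act]. rewrite enc_close1 by reflexivity. rewrite <- app_assoc. f_equal.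
  unfold enc_num. rewrite <- app_assoc.
  destruct (bits_shape n) as [->|[l ->]]; cbn [flat_map]; rewrite <- ?app_assoc, ?app_nil_l;
    rewrite read_tok by lia; cbn [act tr_bits]; rewrite enc_close1 by reflexivity;
    rewrite <- app_assoc; f_equal.
  apply read_digits.
Qed.

Lemma length_tok_app k w : length (tok k ++ w) = 5 + length w.
Proof. reflexivity. Qed.

Lemma atom_end_inv X fs : enc_fo3 atom_end ++ X = flat_map enc_fo3 fs ->
  exists gs, length fs = S (length gs) /\ X = flat_map enc_fo3 gs.
Proof.
  destruct fs as [|f fs]; cbn [flat_map]; intro H; [discriminate|].
  apply prefix_code_fo3 in H as [_ H]. exists fs; auto.
Qed.

Lemma read_digits_inv os : forall w fs, read os MNum1 w = flat_map enc_fo3 fs ->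
  exists l v gs, w = enc_digits l ++ tok 2 ++ v /\ length fs = S (length gs) /\
                 read os MForm v = flat_map enc_fo3 gs.
Proof.
  induction w as [w IH] using (induction_ltof1 _ (@length bool)). unfold ltof in IH.
  intros fs H. destruct (read_cases os w) as [->|[[k [v [Hk ->]]]|E]].
  - destruct (error_ill_formed _ H).
  - rewrite read_tok in H by exact Hk.
    assert (Hbit : forall b : bool, k = (if b then 1 else 0) ->
      flat_map enc_opener (op_bit b) ++ read os MNum1 v = flat_map enc_fo3 fs ->
      exists l v' gs, tok k ++ v = enc_digits l ++ tok 2 ++ v' /\ length fs = S (length gs) /\
                 read os MForm v' = flat_map enc_fo3 gs).
    { intros b -> Hb. apply enc_openers_inv in Hb as [gs [Hg [L _]]]; [|discriminate].
      destruct (IH v) with (fs := gs) as [l [v' [hs [-> [L' Hv]]]]]; auto.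
      { rewrite length_tok_app. lia. }
      exists (b :: l), v', hs. repeat split; auto. cbn in L. lia. }
    destruct k as [|[|[|k]]].
    + apply (Hbit false eq_refl H).
    + apply (Hbit true eq_refl H).
    + apply atom_end_inv in H as [gs [L H]]. exists [], v, gs. auto.
    + destruct (error_ill_formed _ H).
  - rewrite E in H. destruct (error_ill_formed _ H).
Qed.

Lemma read_num_inv os w fs : read os MNum0 w = flat_map enc_fo3 fs ->
  exists p v gs, w = enc_num p ++ v /\ length fs = S (length gs) /\
                 read os MForm v = flat_map enc_fo3 gs.
Proof.
  intro H. destruct (read_cases os w) as [->|[[k [v [Hk ->]]]|E]].
  - destruct (error_ill_formed _ H).
  - rewrite read_tok in H by exact Hk. destruct k as [|[|k]].
    + apply enc_openers_inv in H as [gs [H [L _]]]; [|discriminate].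
      destruct (read_cases os v) as [->|[[k [v' [Hk' ->]]]|E]].
      * destruct (error_ill_formed _ H).
      * rewrite read_tok in H by exact Hk'.
        destruct k as [|[|[|k]]]; try destruct (error_ill_formed _ H).
        apply atom_end_inv in H as [hs [L' H]].
        exists 0, v', hs. repeat split; auto. cbn in L. lia.
      * rewrite E in H. destruct (error_ill_formed _ H).
    + apply enc_openers_inv in H as [gs [H [L _]]]; [|discriminate].
      apply read_digits_inv in H as [l [v' [hs [-> [L' H]]]]].
      destruct (bits_of_digits l) as [p [_ Hp]].
      exists p, v', hs. repeat split; auto; [|cbn in L; lia].
      unfold enc_num. rewrite Hp. cbn [flat_map]. rewrite <- !app_assoc. reflexivity.
    + destruct (error_ill_formed _ H).
  - rewrite E in H. destruct (error_ill_formed _ H).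
Qed.

(** Lists are needed because a binary token leaves two formulas due. Each token changes the number
    of formulas due by the same amount in input and output, so the two parses have equal length. *)
Lemma read_inv os : forall w fs, read os MForm w = flat_map enc_fo3 fs ->
  exists phis, w = flat_map enc_ltl phis /\ length phis = length fs.
Proof.
  induction w as [w IH] using (induction_ltof1 _ (@length bool)). unfold ltof in IH.
  intros fs H. destruct (read_cases os w) as [->|[[k [v [Hk ->]]]|E]].
  - exists []. split; [reflexivity|]. destruct fs as [|f fs]; [reflexivity|].
    destruct (enc_fo3_head f) as [k [s [_ E]]]. cbn [flat_map] in H. rewrite E in H. discriminate.
  - rewrite length_tok_app in IH. rewrite read_tok in H by exact Hk.
    assert (Hnode : forall ops, ops <> [] ->
      flat_map enc_opener ops ++ read os MForm v = flat_map enc_fo3 fs ->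
      exists phis, v = flat_map enc_ltl phis /\
                   S (length phis) = arity ops + length fs /\ fs <> []).
    { intros ops Hn Ho. apply enc_openers_inv in Ho as [gs [Hg [L N]]]; [|exact Hn].
      destruct (IH v ltac:(lia) gs Hg) as [phis [E L']]. exists phis.
      repeat split; auto; lia. }
    assert (H1 : forall (c : ltl -> ltl) ops, ops <> [] -> arity ops = 1 ->
      (forall a, enc_ltl (c a) = tok k ++ enc_ltl a) ->
      flat_map enc_opener ops ++ read os MForm v = flat_map enc_fo3 fs ->
      exists phis, tok k ++ v = flat_map enc_ltl phis /\ length phis = length fs).
    { intros c ops Hn Ha Hc Ho. destruct (Hnode ops Hn Ho) as [phis [-> [L N]]].
      rewrite Ha in L. destruct fs as [|f fs]; [congruence|]. cbn [length] in L.
      destruct phis as [|a phis]; cbn [length] in L; [lia|].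
      exists (c a :: phis). cbn [flat_map length]. rewrite Hc, <- app_assoc.
      split; [reflexivity | lia]. }
    assert (H2 : forall (c : ltl -> ltl -> ltl) ops, ops <> [] -> arity ops = 2 ->
      (forall a b, enc_ltl (c a b) = tok k ++ enc_ltl a ++ enc_ltl b) ->
      flat_map enc_opener ops ++ read os MForm v = flat_map enc_fo3 fs ->
      exists phis, tok k ++ v = flat_map enc_ltl phis /\ length phis = length fs).
    { intros c ops Hn Ha Hc Ho. destruct (Hnode ops Hn Ho) as [phis [-> [L N]]].
      rewrite Ha in L. destruct fs as [|f fs]; [congruence|]. cbn [length] in L.
      destruct phis as [|a [|b phis]]; cbn [length] in L; [lia|lia|].
      exists (c a b :: phis). cbn [flat_map length]. rewrite Hc, <- !app_assoc.
      split; [reflexivity | lia]. }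
    destruct k as [|[|[|[|[|[|[|[|[|[|[|[|[|k]]]]]]]]]]]]]; cbn [act node_openers option_map] in H;
      try destruct (error_ill_formed _ H).
    + apply enc_openers_inv in H as [gs [H [L _]]]; [|discriminate].
      apply read_num_inv in H as [p [v' [hs [-> [L' H]]]]].
      destruct (IH v' ltac:(rewrite length_app; lia) hs H) as [phis [-> L'']].
      exists (LAtom p :: phis). cbn [flat_map length enc_ltl]. rewrite <- app_assoc.
      split; [reflexivity|]. cbn in L. lia.
    + apply (H1 LNeg op_neg); auto; discriminate.
    + apply (H2 LAnd [OAnd]); auto; discriminate.
    + apply (H2 LOr op_or); auto; discriminate.
    + apply (H1 LX op_X); auto; discriminate.
    + apply (H1 LF op_F); auto; discriminate.
    + apply (H1 LG op_G); auto; discriminate.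
    + apply (H2 LU op_U); auto; discriminate.
    + apply (H2 LR op_R); auto; discriminate.
    + apply (H1 LTilde [ONot]); auto; discriminate.
  - rewrite E in H. destruct (error_ill_formed _ H).
Qed.

Lemma openers_reduction (os : list opener) (P : ltl -> Prop) :
  arity os = 1 -> os <> [] -> (forall phi, Delta30 (close os [tr phi]) <-> P phi) ->
  logspace_reducible (fun w => exists phi, w = enc_ltl phi /\ P phi) Delta30_lang.
Proof.
  intros Ha Hn HP. exists (td_fun (reduction os)). split; [apply transducer_logspace|].
  intro w. unfold td_fun. cbn [td_prefix td_start reduction].
  fold (read os MForm w).
  assert (Hf : forall phi,
    flat_map enc_opener os ++ read os MForm (enc_ltl phi) = enc_fo3 (close os [tr phi])).
  { intro phi. rewrite enc_close1 by exact Ha. f_equal.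
    rewrite <- (app_nil_r (enc_ltl phi)), read_ltl. apply app_nil_r. }
  split.
  - intros [phi [-> H]]. exists (close os [tr phi]). split; [apply Hf | apply HP, H].
  - intros [f [E H]].
    assert (Hphi : exists phi, w = enc_ltl phi).
    (* The output is a single formula and the prefix has arity 1, so one formula is left behind the
       prefix and the input is one formula as well. *)
    { rewrite <- (app_nil_r (enc_fo3 f)) in E.
      apply (enc_openers_inv os _ [f] Hn) in E as [gs [Hg [L _]]].
      apply read_inv in Hg as [phis [-> L']]. rewrite Ha in L. cbn [length] in L.
      destruct phis as [|phi [|]]; cbn [length] in L'; try lia.
      exists phi. cbn [flat_map]. apply app_nil_r. }
    destruct Hphi as [phi ->]. exists phi. split; [reflexivity|]. apply HP.
    (* So far [f] only shares its encoding with the translation; unique readability makes them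
       equal, and its truth carries over. *)
    rewrite Hf, <- (app_nil_r (enc_fo3 (close _ _))), <- (app_nil_r (enc_fo3 f)) in E.
    apply prefix_code_fo3 in E as [-> _]. exact H.
Qed.

Theorem mainTheorem10 :
  logspace_reducible SAT_lang Delta30_lang /\
  logspace_reducible FinSAT_lang Delta30_lang.
Proof.
  split.
  - apply (openers_reduction op_sat); [reflexivity | discriminate | exact sat_correct].
  - apply (openers_reduction op_finsat); [reflexivity | discriminate | exact finsat_correct].
Qed.
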